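(* Let $J$ be a bounded Jacobi matrix with $a_j>0$ and $b_j\in\mathbb{C}$ for all $j\ge 0$. Then the spectrum of $|J|$ has multiplicity $\le 2$ and $\delta_0$ is an element of maximal type with respect to $|J|$. In particular, if the spectrum of $|J|$ is simple, then $\delta_0$ is a cyclic element for $|J|$.
   Context: Let $\mathbb{N}_0=\{0,1,2,\dots\}$ and let $\delta_j$, $j\ge0$, be the standard basis of $\ell^2(\mathbb{N}_0)$. A Jacobi matrix with parameters $(a_j)_{j\ge0}$, $(b_j)_{j\ge0}$ is the infinite tridiagonal symmetric matrix $J$ with $J_{j,j}=b_j$, $J_{j,j+1}=J_{j+1,j}=a_j$ and all other entries zero. It is bounded if $\sup_{j\ge0}(|a_j|+|b_j|)<\infty$; it is then regarded as a bounded linear operator on $\ell^2(\mathbb{N}_0)$. We write $|J|=\sqrt{J^*J}$. For a bounded self-adjoint operator $T$ on a Hilbert space: a vector $w$ is cyclic for $T$ if the finite linear combinations of $T^m w$, $m\ge0$, are dense; the spectrum of $T$ is simple if a cyclic vector exists. $T$ has spectrum of multiplicity $\le m$ if $T$ is unitarily equivalent to an orthogonal sum of no more than $m$ operators with simple spectrum. A vector $w$ is an element of maximal type with respect to $T$ if for every Borel set $\Delta\subset\mathbb{R}$, $\chi_\Delta(T)w=0$ implies $\chi_\Delta(T)=0$, where $\chi_\Delta$ is the indicator function of $\Delta$ and $\chi_\Delta(T)$ is defined by the functional calculus. *)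

(* Defs.v *)
From HB Require Import structures.
From mathcomp Require Import all_boot all_order all_algebra.
From mathcomp Require Import all_classical all_reals all_analysis.
From mathcomp Require Import complex sesquilinear ring lra.

Set Implicit Arguments.
Unset Strict Implicit.
Unset Printing Implicit Defensive.

Import Order.TTheory GRing.Theory Num.Theory.
Import numFieldNormedType.Exports.

Local Open Scope classical_set_scope.
Local Open Scope ring_scope.
Local Open Scope complex_scope.

Local Notation conjC := Num.conj.
Local Notation Re := complex.Re.
Local Notation Im := complex.Im.

Section DotNorm.
Variables (R : realType) (V : lmodType R[i]) (f : {dot V for conjC}).

Definition dot_norm (x : V) : R := Num.sqrt (Re (f x x)).

Definition dot_complete : Prop :=
  forall u : nat -> V,
    (forall e : R, 0 < e -> exists N : nat, forall m n : nat,
        (N <= m)%N -> (N <= n)%N -> dot_norm (u m - u n) < e) ->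
    exists l : V, (fun n => dot_norm (u n - l)) @ \oo --> (0 : R).

End DotNorm.

(* [hdot] is linear in its first argument, conjugate-linear in the second. *)
HB.mixin Record Lmodule_isHilbert (R : realType) V of GRing.Lmodule R[i] V := {
  hdot : {dot V for conjC};
  hilbert_complete : dot_complete hdot
}.

#[short(type="hilbertType")]
HB.structure Definition Hilbert (R : realType) :=
  {V of GRing.Lmodule R[i] V & Lmodule_isHilbert R V}.

Definition hnorm (R : realType) (V : hilbertType R) (x : V) : R :=
  dot_norm (hdot (s := V)) x.

Section DotConstruction.
Variables (R : realType) (V : lmodType R[i]) (f : V -> V -> R[i]).
Hypothesis fP : forall z x y w, f (z *: x + y) w = z * f x w + f y w.
Hypothesis fC : forall x y, f x y = conjC (f y x).

Lemma dot_bilinear_for : bilinear_for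
  (GRing.Scale.Law.clone _ _ *%R _) (GRing.Scale.Law.clone _ _ (conjC \; *%R) _)
  f.
Proof.
split=> [w|x] z y1 y2 /=; first exact: fP.
by rewrite fC fP rmorphD rmorphM/= -!fC.
Qed.

Lemma dot_hermitian x y : f x y = (-1) ^+ false * conjC (f y x).
Proof. by rewrite mul1r. Qed.

End DotConstruction.

Lemma dot_norm_ge0 (R : realType) (V : lmodType R[i]) (f : {dot V for conjC})
  (x : V) : 0 <= dot_norm f x.
Proof. exact: sqrtr_ge0. Qed.

Lemma sqr_dot_norm (R : realType) (V : lmodType R[i]) (f : {dot V for conjC})
  (x : V) : dot_norm f x ^+ 2 = Re (f x x).
Proof.
by rewrite sqr_sqrtr//; have := dnorm_ge0 f x; rewrite lecE => /andP[].
Qed.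

Lemma cauchy_cvgn (R : realType) (u : nat -> R) :
  (forall e : R, 0 < e -> exists N : nat, forall m n : nat,
     (N <= m)%N -> (N <= n)%N -> `|u m - u n| < e) ->
  cvgn u.
Proof.
move=> cu; apply: cauchy_cvg; apply: cauchy_exP => e e0.
by have [N uN] := cu e e0; exists (u N), N => // n /= Nn; exact: uN.
Qed.

Section ComplexSeries.
Variable R : realType.
Implicit Types (u v : nat -> R[i]) (z l : R[i]).

Definition has_csum u l : Prop :=
  series (fun k => Re (u k)) @ \oo --> Re l /\
  series (fun k => Im (u k)) @ \oo --> Im l.

Definition csum u : R[i] :=
  limn (series (fun k => Re (u k))) +i* limn (series (fun k => Im (u k))).

Lemma has_csumE u l : has_csum u l -> csum u = l.
Proof.
case: l => a b [/= ha hb]; rewrite /csum.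
by rewrite (cvg_lim _ ha)// (cvg_lim _ hb).
Qed.

Let serP (a b : R) (f g h : nat -> R) (lf lg : R) :
  (forall k, h k = a * f k + b * g k) ->
  series f @ \oo --> lf -> series g @ \oo --> lg ->
  series h @ \oo --> a * lf + b * lg.
Proof.
move=> hE cf cg.
have -> : series h = (fun n => a * series f n + b * series g n).
  apply/funext => n; rewrite /series/= !big_distrr/= -big_split/=.
  by apply: eq_bigr => k _; rewrite hE.
by apply: cvgD; apply: cvgM => //; exact: cvg_cst.
Qed.

Let ReP z l m : Re (z * l + m) = Re z * Re l - Im z * Im l + Re m.
Proof. by case: z l m => [? ?] [? ?] [? ?]. Qed.

Let ImP z l m : Im (z * l + m) = Re z * Im l + Im z * Re l + Im m.
Proof. by case: z l m => [? ?] [? ?] [? ?]. Qed.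

Lemma has_csumP z u v l m : has_csum u l -> has_csum v m ->
  has_csum (fun k => z * u k + v k) (z * l + m).
Proof.
move=> [u1 u2] [v1 v2]; split.
  have -> : Re (z * l + m) = 1 * (Re z * Re l + (- Im z) * Im l) + 1 * Re m.
    by rewrite ReP; ring.
  apply: (serP (f := fun k => Re z * Re (u k) + (- Im z) * Im (u k)) _ _ v1).
    by move=> k; rewrite ReP; ring.
  exact: (serP _ u1 u2).
have -> : Im (z * l + m) = 1 * (Im z * Re l + Re z * Im l) + 1 * Im m.
  by rewrite ImP; ring.
apply: (serP (f := fun k => Im z * Re (u k) + Re z * Im (u k)) _ _ v2).
  by move=> k; rewrite ImP; ring.
exact: (serP _ u1 u2).
Qed.

Lemma conjcE z : conjC z = Re z -i* Im z.
Proof. by case: z. Qed.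

Lemma has_csumC u l : has_csum u l ->
  has_csum (fun k => conjC (u k)) (conjC l).
Proof.
move=> [u1 u2]; split.
  have -> : Re (conjC l) = Re l by rewrite conjcE.
  by under [X in series X]eq_fun do rewrite conjcE/=.
have -> : Im (conjC l) = (-1) * Im l + 0 * Im l by rewrite conjcE/=; ring.
by apply: (serP _ u2 u2) => k; rewrite conjcE/=; ring.
Qed.

Definition sqabs z : R := Re (`|z| ^+ 2).

Lemma sqabsE z : sqabs z = Re z ^+ 2 + Im z ^+ 2.
Proof. by rewrite /sqabs normCK conjcE; case: z => a b /=; ring. Qed.

Lemma sqabs_ge0 z : 0 <= sqabs z.
Proof. by rewrite sqabsE addr_ge0 ?sqr_ge0. Qed.

Lemma sqabs_eq0 z : sqabs z = 0 -> z = 0.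
Proof.
rewrite sqabsE => /eqP; rewrite paddr_eq0 ?sqr_ge0// !sqrf_eq0.
by case: z => a b /= /andP[/eqP -> /eqP ->].
Qed.

End ComplexSeries.

Lemma sqabsP (R : realType) (z x y : R[i]) :
  sqabs (z * x + y) <= 2 * sqabs z * sqabs x + 2 * sqabs y.
Proof.
rewrite !sqabsE; case: z x y => [a b] [c d] [e f] /=; rewrite -subr_ge0.
set r := (X in 0 <= X).
have -> : r = (a * c - b * d - e) ^+ 2 + (a * d + b * c - f) ^+ 2.
  by rewrite /r; ring.
by rewrite addr_ge0 ?sqr_ge0.
Qed.

Lemma sqabs_mulP (R : realType) (x y : R[i]) :
  `|Re (x * conjC y)| <= sqabs x + sqabs y /\
  `|Im (x * conjC y)| <= sqabs x + sqabs y.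
Proof.
rewrite !sqabsE conjcE; case: x y => [a b] [c d] /=.
have key (p q r s : R) :
    `|p * q + r * s| <= p ^+ 2 + q ^+ 2 + (r ^+ 2 + s ^+ 2).
  have h1 := sqr_ge0 (p + q); have h2 := sqr_ge0 (r + s).
  have h3 := sqr_ge0 (p - q); have h4 := sqr_ge0 (r - s).
  have [h5 h6 h7 h8] := And4 (sqr_ge0 p) (sqr_ge0 q) (sqr_ge0 r) (sqr_ge0 s).
  by rewrite ler_norml; apply/andP; split; nra.
split.
  by have := key a c b d; rewrite mulrN opprK; congr (_ <= _); ring.
by have := key a (- d) b c; congr (_ <= _); ring.
Qed.

Definition square_summable (R : realType) (x : nat -> R[i]) : Prop :=
  cvgn (series (fun k => sqabs (x k))).

Section SquareSummable.
Variable R : realType.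
Implicit Types (x y : nat -> R[i]).

Lemma square_summable_le x (w : nat -> R) : (forall k, sqabs (x k) <= w k) ->
  cvgn (series w) -> square_summable x.
Proof.
move=> xw; apply: series_le_cvg => // k; first exact: sqabs_ge0.
exact: le_trans (sqabs_ge0 _) (xw k).
Qed.

Lemma square_summableP (z : R[i]) x y : square_summable x -> square_summable y ->
  square_summable (fun k => z * x k + y k).
Proof.
move=> sx sy.
pose w k : R := (2 * sqabs z) * sqabs (x k) + 2 * sqabs (y k).
apply: (@square_summable_le _ w).
  by move=> k; exact: sqabsP.
have -> : series w =
    (2 * sqabs z) *: series (fun k => sqabs (x k))
      + 2 *: series (fun k => sqabs (y k)).
  by apply/funext => n; rewrite /series/= big_split/= -!big_distrr.
by apply: is_cvgD; apply: is_cvgZl_tmp.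
Qed.

Lemma square_summable0 : square_summable (fun=> 0 : R[i]).
Proof.
rewrite /square_summable.
have -> : series (fun=> sqabs (0 : R[i])) = (fun=> 0).
  by apply/funext => n; rewrite /series/= big1// => k _; rewrite sqabsE/=; ring.
exact: is_cvg_cst.
Qed.

Lemma has_csum_mul x y : square_summable x -> square_summable y ->
  has_csum (fun k => x k * conjC (y k)) (csum (fun k => x k * conjC (y k))).
Proof.
move=> sx sy.
have cw : cvgn (series (fun k => sqabs (x k) + sqabs (y k))).
  have -> : series (fun k => sqabs (x k) + sqabs (y k)) =
     series (fun k => sqabs (x k)) + series (fun k => sqabs (y k)).
    by apply/funext => n; rewrite /series/= fctE/= -big_split.
  exact: is_cvgD.
have main (f : nat -> R) : (forall k, `|f k| <= sqabs (x k) + sqabs (y k)) ->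
    cvgn (series f).
  move=> fle; apply: normed_cvg.
  apply: (series_le_cvg _ _ fle cw) => k; first exact: normr_ge0.
  by rewrite addr_ge0 ?sqabs_ge0.
by split; apply: main => k; [exact: (sqabs_mulP _ _).1 | exact: (sqabs_mulP _ _).2].
Qed.

End SquareSummable.
Arguments square_summableP {R} z {x y} _ _.

Section Ell2.
Variable R : realType.

Definition ell2_pred : {pred nat -> R[i]} := fun x => `[< square_summable x >].

Lemma ell2_submod_closed : submod_closed ell2_pred.
Proof.
split; first by apply/asboolP; exact: square_summable0.
by move=> z x y /asboolP sx /asboolP sy; apply/asboolP; exact: square_summableP.
Qed.

HB.instance Definition _ :=
  GRing.isSubmodClosed.Build R[i] (nat -> R[i]) ell2_pred ell2_submod_closed.

Record ell2 : Type := Ell2 {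
  ell2_seq :> nat -> R[i];
  ell2_seqP : ell2_seq \in ell2_pred
}.

HB.instance Definition _ := [isSub for ell2_seq].
HB.instance Definition _ := [Choice of ell2 by <:].
HB.instance Definition _ := [SubChoice_isSubLmodule of ell2 by <:].

Lemma ell2P (x : ell2) : square_summable x.
Proof. exact/asboolP/(ell2_seqP x). Qed.
Arguments ell2P : clear implicits.

Definition mk_ell2 (x : nat -> R[i]) (sx : square_summable x) : ell2 :=
  Ell2 (asboolT sx).

Definition ell2_dot (x y : ell2) : R[i] := csum (fun k => x k * conjC (y k)).


Lemma ell2_dotP z (x y w : ell2) :
  ell2_dot (z *: x + y) w = z * ell2_dot x w + ell2_dot y w.
Proof.
apply: has_csumE.
have := has_csumP z (has_csum_mul (ell2P x) (ell2P w))
  (has_csum_mul (ell2P y) (ell2P w)).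
by under [X in has_csum X _ -> _]eq_fun do rewrite mulrA -mulrDl.
Qed.

Lemma ell2_dotC (x y : ell2) : ell2_dot x y = conjC (ell2_dot y x).
Proof.
apply: has_csumE; have := has_csumC (has_csum_mul (ell2P y) (ell2P x)).
by under [X in has_csum X _ -> _]eq_fun do rewrite rmorphM/= conjCK mulrC.
Qed.

Lemma sum_sqabs_le (x : ell2) n :
  \sum_(0 <= k < n) sqabs (x k) <= Re (ell2_dot x x).
Proof.
have [+ _] := has_csum_mul (ell2P x) (ell2P x); rewrite -/(ell2_dot x x).
under [X in series X]eq_fun do rewrite -normCK.
move=> cx; rewrite -(cvg_lim _ cx)//.
apply: (nondecreasing_cvgn_le _ (cvgP _ cx) n).
by apply: nondecreasing_series => k _ _; exact: sqabs_ge0.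
Qed.

Lemma ell2_dot_le (x : ell2) (M : R) :
  (forall n, \sum_(0 <= k < n) sqabs (x k) <= M) -> Re (ell2_dot x x) <= M.
Proof.
move=> xM; have [+ _] := has_csum_mul (ell2P x) (ell2P x).
rewrite -/(ell2_dot x x); under [X in series X]eq_fun do rewrite -normCK.
move=> cx; rewrite -(cvg_lim _ cx)//; apply: limr_le; first exact: cvgP cx.
by near=> n; exact: xM.
Unshelve. all: by end_near. Qed.

Lemma ell2_dot_gt0 (x : ell2) : x != 0 -> 0 < ell2_dot x x.
Proof.
move=> x0; have [k xk] : exists k, x k != 0.
  apply: contrapT => xE; move/eqP: x0; apply; apply: val_inj.
  apply/funext => k; apply/eqP/negPn/negP => xk; apply: xE; by exists k.
have x_gt0 : 0 < Re (ell2_dot x x).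
  apply: lt_le_trans (sum_sqabs_le x k.+1); rewrite big_nat_recr//=.
  rewrite ltr_wpDl ?sumr_ge0// => [i _|]; first exact: sqabs_ge0.
  rewrite lt_neqAle sqabs_ge0 andbT eq_sym.
  by apply/eqP => /sqabs_eq0 /eqP; rewrite (negPf xk).
have := congr1 (@complex.Im R) (ell2_dotC x x); rewrite conjcE/= => h.
by rewrite ltcE x_gt0 andbT/=; apply/eqP; lra.
Qed.

HB.instance Definition _ := bilinear_isBilinear.Build R[i] ell2 ell2 R[i] _ _
  ell2_dot (dot_bilinear_for ell2_dotP ell2_dotC).
HB.instance Definition _ := isHermitianSesquilinear.Build R[i] ell2 false conjC
  ell2_dot (dot_hermitian ell2_dotC).
HB.instance Definition _ := isDotProduct.Build R[i] ell2 ell2_dot ell2_dot_gt0.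

Lemma sum_sqabs_cvg (x : nat -> nat -> R[i]) (y z : nat -> R[i]) n :
  (forall k, (fun m => Re (x m k)) @ \oo --> Re (y k)) ->
  (forall k, (fun m => Im (x m k)) @ \oo --> Im (y k)) ->
  (fun m => \sum_(0 <= k < n) sqabs (z k - x m k)) @ \oo -->
  \sum_(0 <= k < n) sqabs (z k - y k).
Proof.
move=> xRe xIm; elim: n => [|n ih].
  by under eq_fun do rewrite big_nil; rewrite big_nil; exact: cvg_cst.
under eq_fun do rewrite big_nat_recr//=; rewrite big_nat_recr//=.
apply: cvgD => //.
have sqE (p q : R[i]) : sqabs (p - q) =
    (Re p - Re q) * (Re p - Re q) + (Im p - Im q) * (Im p - Im q).
  by rewrite sqabsE; case: p q => [a b] [c d] /=; ring.
under eq_fun do rewrite sqE; rewrite sqE.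
by apply: cvgD; apply: cvgM; apply: cvgB => //; exact: cvg_cst.
Qed.

Lemma ell2_complete : dot_complete ell2_dot.
Proof.
move=> u cu.
have coord (g : R[i] -> R) : (forall z, g z ^+ 2 <= sqabs z) ->
    (forall z w, g (z - w) = g z - g w) -> forall k, cvgn (fun m => g (u m k)).
  move=> gle gB k; apply: cauchy_cvgn => e e0; have [N uN] := cu e e0.
  exists N => m n Nm Nn; apply: le_lt_trans (uN m n Nm Nn); rewrite -gB.
  rewrite -(@ler_pXn2r _ 2) ?nnegrE ?dot_norm_ge0// real_normK ?num_real//.
  rewrite sqr_dot_norm (le_trans _ (sum_sqabs_le _ k.+1))//.
  rewrite (le_trans (gle _))// big_nat_recr//= lerDr sumr_ge0// => i _.
  exact: sqabs_ge0.
have cRe k : cvgn (fun m => Re (u m k)).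
  apply: coord => [z|]; last by case=> [a b] [c d].
  by rewrite sqabsE lerDl sqr_ge0.
have cIm k : cvgn (fun m => Im (u m k)).
  apply: coord => [z|]; last by case=> [a b] [c d].
  by rewrite sqabsE lerDr sqr_ge0.
pose l k := limn (fun m => Re (u m k)) +i* limn (fun m => Im (u m k)).
have ul e : 0 < e -> exists N, forall n, (N <= n)%N ->
    forall K, \sum_(0 <= k < K) sqabs (u n k - l k) <= e ^+ 2.
  move=> e0; have [N uN] := cu e e0; exists N => n Nn K.
  have cs : (fun m => \sum_(0 <= k < K) sqabs (u n k - u m k)) @ \oo -->
      \sum_(0 <= k < K) sqabs (u n k - l k).
    by apply: sum_sqabs_cvg => k; [exact: cRe | exact: cIm].
  rewrite -(cvg_lim _ cs)//; apply: limr_le; first exact: cvgP cs.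
  near=> m; apply: le_trans (sum_sqabs_le (u n - u m) K) _.
  rewrite -[leLHS](sqr_dot_norm ell2_dot) ler_pXn2r ?nnegrE ?dot_norm_ge0 ?ltW//.
  by apply: uN => //; near: m; exact: nbhs_infty_ge.
have sl n (M : R) :
    (forall K, \sum_(0 <= k < K) sqabs (u n k - l k) <= M) ->
    square_summable (fun k => u n k - l k).
  move=> uM; apply: nondecreasing_is_cvgn.
    by apply: nondecreasing_series => k _ _; exact: sqabs_ge0.
  by exists M => _ [K _ <-]; exact: uM.
have l2 : square_summable l.
  have [N uN] := ul 1 ltr01.
  have s1 := sl N _ (uN N (leqnn N)).
  have := square_summableP (-1) s1 (ell2P (u N)).
  by under [X in square_summable X]eq_fun do rewrite mulN1r opprB subrK.
exists (mk_ell2 l2); apply/cvgrPdist_le => e e0.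
have [N uN] := ul e e0; exists N => // n /= Nn.
rewrite sub0r normrN ger0_norm ?dot_norm_ge0//.
rewrite -(@ler_pXn2r _ 2) ?nnegrE ?dot_norm_ge0 ?(ltW e0)// sqr_dot_norm.
exact: (@ell2_dot_le (u n - mk_ell2 l2) _ (uN n Nn)).
Unshelve. all: by end_near. Qed.

HB.instance Definition _ := Lmodule_isHilbert.Build R ell2 ell2_complete.

Lemma square_summable_delta (j : nat) :
  square_summable (fun k => (k == j)%:R : R[i]).
Proof.
apply: nondecreasing_is_cvgn.
  by apply: nondecreasing_series => k _ _; exact: sqabs_ge0.
have sq k : sqabs ((k == j)%:R : R[i]) = (k == j)%:R :> R.
  by rewrite sqabsE; case: eqP => _ /=; ring.
exists 1 => _ [n _ <-]; rewrite /series/=.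
under eq_bigr do rewrite sq.
have [jn|nj] := ltnP j n.
  rewrite (bigD1_seq j) ?iota_uniq ?mem_index_iota//= eqxx big1 ?addr0// => k.
  by move=> /negPf ->.
rewrite big_nat big1// => k /andP[_ kn].
by rewrite ltn_eqF// (leq_trans kn nj).
Qed.

Arguments square_summable_delta : clear implicits.

Definition delta (j : nat) : ell2 := mk_ell2 (square_summable_delta j).

End Ell2.

Arguments ell2 : clear implicits.
Arguments ell2P {R} x.
Arguments delta : clear implicits.

Section OrthogonalSum.
Variables (R : realType) (n : nat) (K : 'I_n -> hilbertType R).

Definition osum : Type := forall i, K i.

HB.instance Definition _ := gen_eqMixin osum.
HB.instance Definition _ := gen_choiceMixin osum.

Definition osum_zero : osum := fun=> 0.
Definition osum_opp (x : osum) : osum := fun i => - x i.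
Definition osum_add (x y : osum) : osum := fun i => x i + y i.
Definition osum_scale (z : R[i]) (x : osum) : osum := fun i => z *: x i.

Let ext (x y : osum) : (forall i, x i = y i) -> x = y.
Proof. exact: functional_extensionality_dep. Qed.

Let addA : associative osum_add.
Proof. by move=> x y z; apply: ext => i; exact: addrA. Qed.
Let addC : commutative osum_add.
Proof. by move=> x y; apply: ext => i; exact: addrC. Qed.
Let add0 : left_id osum_zero osum_add.
Proof. by move=> x; apply: ext => i; exact: add0r. Qed.
Let addN : left_inverse osum_zero osum_opp osum_add.
Proof. by move=> x; apply: ext => i; exact: addNr. Qed.

HB.instance Definition _ := GRing.isZmodule.Build osum addA addC add0 addN.

Let scaleA z w (x : osum) : osum_scale z (osum_scale w x) = osum_scale (z * w) x.
Proof. by apply: ext => i; exact: scalerA. Qed.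
Let scale1 : left_id 1 osum_scale.
Proof. by move=> x; apply: ext => i; exact: scale1r. Qed.
Let scaleDr : right_distributive osum_scale +%R.
Proof. by move=> z x y; apply: ext => i; exact: scalerDr. Qed.
Let scaleDl (x : osum) : {morph osum_scale^~ x : z w / z + w}.
Proof. by move=> z w; apply: ext => i; exact: scalerDl. Qed.

HB.instance Definition _ :=
  GRing.Zmodule_isLmodule.Build R[i] osum scaleA scale1 scaleDr scaleDl.

Definition osum_dot (x y : osum) : R[i] := \sum_i hdot (x i) (y i).

Lemma osum_dotP z (x y w : osum) :
  osum_dot (z *: x + y) w = z * osum_dot x w + osum_dot y w.
Proof.
rewrite /osum_dot big_distrr/= -big_split; apply: eq_bigr => i _ /=.
by rewrite linearDl linearZl_LR.
Qed.

Lemma osum_dotC (x y : osum) : osum_dot x y = conjC (osum_dot y x).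
Proof.
rewrite /osum_dot rmorph_sum; apply: eq_bigr => i _.
by rewrite hermC mul1r.
Qed.

Lemma osum_dot_gt0 (x : osum) : x != 0 -> 0 < osum_dot x x.
Proof.
move=> x0; have [i xi] : exists i, x i != 0.
  apply: contrapT => xE; move/eqP: x0; apply; apply: ext => i.
  by apply/eqP/negPn/negP => xi; apply: xE; exists i.
by rewrite /osum_dot (bigD1 i)//= ltr_pwDl ?dnorm_gt0// sumr_ge0.
Qed.

HB.instance Definition _ := bilinear_isBilinear.Build R[i] osum osum R[i] _ _
  osum_dot (dot_bilinear_for osum_dotP osum_dotC).
HB.instance Definition _ := isHermitianSesquilinear.Build R[i] osum false conjC
  osum_dot (dot_hermitian osum_dotC).
HB.instance Definition _ := isDotProduct.Build R[i] osum osum_dot osum_dot_gt0.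

Lemma osum_dot_norm (x : osum) :
  dot_norm osum_dot x ^+ 2 = \sum_i hnorm (x i) ^+ 2.
Proof.
rewrite sqr_dot_norm /osum_dot.
rewrite (big_morph (@complex.Re R) (id1 := 0) (op1 := +%R))//; last first.
  by case=> [a b] [c d].
by apply: eq_bigr => i _; rewrite /hnorm sqr_dot_norm.
Qed.

Lemma osum_complete : dot_complete osum_dot.
Proof.
move=> u cu.
have ci i : exists l : K i, (fun m => hnorm (u m i - l)) @ \oo --> (0 : R).
  apply: (hilbert_complete (s := K i) (fun m => u m i)) => e e0.
  have [N uN] := cu e e0; exists N => m p Nm Np.
  apply: le_lt_trans (uN m p Nm Np).
  rewrite -(@ler_pXn2r _ 2) ?nnegrE ?dot_norm_ge0// osum_dot_norm.
  by rewrite (bigD1 i)//= lerDl sumr_ge0// => k _; exact: sqr_ge0.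
pose l : osum := fun i => projT1 (cid (ci i)).
have ul i : (fun m => hnorm (u m i - l i)) @ \oo --> (0 : R).
  exact: projT2 (cid (ci i)).
exists l.
have -> : (fun m => dot_norm osum_dot (u m - l)) =
    (fun m => Num.sqrt (\sum_i hnorm (u m i - l i) ^+ 2)).
  apply/funext => m; rewrite -osum_dot_norm.
  by rewrite sqrtr_sqr ger0_norm// dot_norm_ge0.
rewrite -[X in _ --> X]sqrtr0.
apply: continuous_cvg; first exact: sqrt_continuous.
elim: (index_enum 'I_n) => [|i r ih].
  by under eq_fun do rewrite big_nil; exact: cvg_cst.
under eq_fun do rewrite big_cons expr2.
by have := cvgD (cvgM (ul i) (ul i)) ih; rewrite mulr0 addr0 => h; apply: h.
Qed.

HB.instance Definition _ := Lmodule_isHilbert.Build R osum osum_complete.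

Definition osum_op (T : forall i, K i -> K i) (x : osum) : osum :=
  fun i => T i (x i).

End OrthogonalSum.

Arguments osum_op {R n K} T x.

Section Operators.
Variables (R : realType) (H : hilbertType R).
Implicit Types (T S B : H -> H) (w x y : H) (E : set R -> H -> H) (f : R -> R).

Definition bounded_op T : Prop :=
  linear T /\ exists M : R, forall x, hnorm (T x) <= M * hnorm x.

Definition self_adjoint T : Prop :=
  forall x y, hdot (T x) y = hdot x (T y).

(* The order on [R[i]] makes [0 <= z] mean "z is real and nonnegative". *)
Definition positive_op T : Prop :=
  [/\ bounded_op T, self_adjoint T & forall x, 0 <= hdot (T x) x].

(* [adjoint T], [sqrt_op T] and [functional_calculus T f] are selected by
   classical choice from a set which, in the cases of interest (T bounded,
   T positive, T bounded self-adjoint and f bounded Borel, respectively), has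
   exactly one element; when that set is empty they are the zero operator. *)
Definition adjoint T : H -> H :=
  xget 0 [set S | bounded_op S /\ forall x y, hdot (T x) y = hdot x (S y)].

Definition sqrt_op T : H -> H :=
  xget 0 [set S | positive_op S /\ forall x, S (S x) = T x].

Definition abs_op T : H -> H := sqrt_op (adjoint T \o T).

Definition orthogonal_projection T : Prop :=
  [/\ bounded_op T, self_adjoint T & forall x, T (T x) = T x].

(* [mu] is the measure Delta |-> <E(Delta) x, x>. *)
Definition scalar_measure E x (mu : {measure set R -> \bar R}) : Prop :=
  forall D : set R, measurable D -> mu D = (Re (hdot (E D x) x))%:E.

(* Projection-valued Borel measure on the real line; countable additivity is
   the existence of all the measures <E(.) x, x>.  The values of [E] on
   non-Borel sets are irrelevant. *)
Definition projection_valued_measure E : Prop :=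
  [/\ forall D : set R, measurable D -> orthogonal_projection (E D),
      forall x, E setT x = x &
      forall x, exists mu : {measure set R -> \bar R}, scalar_measure E x mu].

(* B is the integral of f(t) dE(t), in the weak sense. *)
Definition spectral_integral E f B : Prop :=
  forall x, exists2 mu : {measure set R -> \bar R}, scalar_measure E x mu &
    mu.-integrable setT (EFin \o f) /\
    hdot (B x) x = (\int[mu]_(t in setT) f t)%:C.

Definition spectral_measure T E : Prop :=
  projection_valued_measure E /\ spectral_integral E id T.

(* In particular functional_calculus T \1_D is the spectral projection E(D). *)
Definition functional_calculus T f : H -> H :=
  xget 0 [set B | bounded_op B /\
    exists2 E, spectral_measure T E & spectral_integral E f B].

Definition maximal_type T w : Prop :=
  forall D : set R, measurable D ->
    functional_calculus T \1_D w = 0 ->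
    forall x, functional_calculus T \1_D x = 0.

Definition cyclic_vector T w : Prop :=
  forall (x : H) (e : R), 0 < e ->
    exists (n : nat) (c : 'I_n -> R[i]),
      hnorm (x - \sum_(m < n) c m *: iter m T w) < e.

Definition simple_spectrum T : Prop := exists w, cyclic_vector T w.

End Operators.

Definition unitary (R : realType) (H K : hilbertType R) (U : H -> K) : Prop :=
  [/\ linear U, forall y, exists x, U x = y &
      forall x y, hdot (U x) (U y) = hdot x y].

Definition unitarily_equivalent (R : realType) (H K : hilbertType R)
    (T : H -> H) (S : K -> K) : Prop :=
  exists2 U : H -> K, unitary U & forall x, U (T x) = S (U x).

Definition multiplicity_le (R : realType) (H : hilbertType R) (T : H -> H)
    (m : nat) : Prop :=
  exists (n : nat) (K : 'I_n -> hilbertType R) (S : forall i, K i -> K i),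
    [/\ (n <= m)%N,
        forall i, [/\ bounded_op (S i), self_adjoint (S i)
                    & simple_spectrum (S i)] &
        unitarily_equivalent T (osum_op S : osum K -> osum K)].

Section Jacobi.
Variables (R : realType) (a : nat -> R) (b : nat -> R[i]).

Definition jacobi_matrix (j k : nat) : R[i] :=
  if k == j then b j
  else if k == j.+1 then (a j)%:C
  else if j == k.+1 then (a k)%:C
  else 0.

Definition jacobi_bounded : Prop :=
  exists M : R, forall j, `|(a j)%:C| + `|b j| <= M%:C.

(* Row j of the matrix vanishes beyond column j + 1. *)
Definition jacobi_seq (x : nat -> R[i]) (j : nat) : R[i] :=
  \sum_(k < j.+2) jacobi_matrix j k * x k.

Lemma jacobi_seqE x : jacobi_seq x =
  fun j => (if j is i.+1 then (a i)%:C * x i else 0)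
           + (b j * x j + (a j)%:C * x j.+1).
Proof.
apply/funext => -[|j]; rewrite /jacobi_seq/jacobi_matrix.
  by rewrite big_ord_recr big_ord1/= add0r.
rewrite !big_ord_recr/= big1 ?add0r; last first.
  move=> k _; have kj : (k < j)%N := ltn_ord k.
  rewrite [k == j.+1 :> nat]ltn_eqF ?(ltn_trans kj)//.
  by rewrite [k == j.+2 :> nat]ltn_eqF ?(ltn_trans kj)// eqSS gtn_eqF ?mul0r.
rewrite (ltn_eqF (ltnSn j)) (ltn_eqF (leqnSn j.+1)) (gtn_eqF (ltnSn j.+1)).
by rewrite !eqxx addrA.
Qed.

Lemma square_summableM (c x : nat -> R[i]) (M : R) :
  (forall k, `|c k| <= M%:C) -> square_summable x ->
  square_summable (fun k => c k * x k).
Proof.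
move=> cM sx; apply: (@square_summable_le _ _ (fun k => M ^+ 2 * sqabs (x k))).
  move=> k; have M0 : 0 <= M.
    by have := le_trans (normr_ge0 _) (cM 0%N); rewrite ler0c.
  have : `|c k * x k| ^+ 2 <= (M%:C) ^+ 2 * `|x k| ^+ 2.
    rewrite normrM exprMn ler_wpM2r ?exprn_ge0//.
    by rewrite ler_pXn2r ?nnegrE ?normr_ge0 ?ler0c.
  have -> : M%:C ^+ 2 = (M ^+ 2)%:C by rewrite rmorphXn.
  rewrite lecE => /andP[_]; congr (_ <= _).
  by rewrite /sqabs; case: (`|x k| ^+ 2) => p q /=; ring.
have -> : series (fun k => M ^+ 2 * sqabs (x k)) =
    M ^+ 2 *: series (fun k => sqabs (x k)).
  by apply/funext => n; rewrite /series/= -big_distrr.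
exact: is_cvgZl_tmp.
Qed.

Lemma square_summable_shiftl (x : nat -> R[i]) : square_summable x ->
  square_summable (fun k => x k.+1).
Proof.
move=> sx; apply: nondecreasing_is_cvgn.
  by apply: nondecreasing_series => k _ _; exact: sqabs_ge0.
exists (limn (series (fun k => sqabs (x k)))) => _ [n _ <-].
apply: le_trans (nondecreasing_cvgn_le _ sx n.+1); last first.
  by apply: nondecreasing_series => k _ _; exact: sqabs_ge0.
by rewrite /series/= big_nat_recl// lerDr sqabs_ge0.
Qed.

Lemma square_summable_shiftr (x : nat -> R[i]) : square_summable x ->
  square_summable (fun k => if k is i.+1 then x i else 0).
Proof.
move=> sx; apply: nondecreasing_is_cvgn.
  by apply: nondecreasing_series => k _ _; exact: sqabs_ge0.
exists (limn (series (fun k => sqabs (x k)))) => _ [[|n] _ <-].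
  rewrite /series/= big_nil.
  have := nondecreasing_cvgn_le _ sx 0%N; rewrite /series/= big_nil; apply.
  by apply: nondecreasing_series => k _ _; exact: sqabs_ge0.
apply: le_trans (nondecreasing_cvgn_le _ sx n); last first.
  by apply: nondecreasing_series => k _ _; exact: sqabs_ge0.
rewrite /series/= big_nat_recl//= sqabsE/= expr0n/= addr0 add0r.
by under eq_bigr do rewrite /=.
Qed.

Lemma square_summable_jacobi (x : nat -> R[i]) : jacobi_bounded ->
  square_summable x -> square_summable (jacobi_seq x).
Proof.
move=> [M abM] sx.
have aM k : `|(a k)%:C| <= M%:C by apply: le_trans (abM k); rewrite lerDl.
have bM k : `|b k| <= M%:C by apply: le_trans (abM k); rewrite lerDr.
have s1 := square_summable_shiftr (square_summableM aM sx).
have s2 := square_summableM bM sx.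
have s3 := square_summableM aM (square_summable_shiftl sx).
have := square_summableP 1 s1 (square_summableP 1 s2 s3).
by rewrite jacobi_seqE; under [X in square_summable X -> _]eq_fun do rewrite !mul1r.
Qed.

Definition jacobi (ab : jacobi_bounded) (x : ell2 R) : ell2 R :=
  mk_ell2 (square_summable_jacobi ab (ell2P x)).

End Jacobi.

(* Main.v *)
From HB Require Import structures.
Require Import Defs.
From mathcomp Require Import all_boot all_order all_algebra.
From mathcomp Require Import all_classical all_reals all_analysis.
From mathcomp Require Import measurable_realfun complex sesquilinear ring lra.

(** Let [C] be complex conjugation in the sequence space and [A = C J].  The
    matrix of [J] is symmetric, so the adjoint of [J] is [C J C]; hence [A] is a
    bounded conjugate-linear operator with [<A x, y> = <A y, x>]
    ([conj_jacobi_sym]), and [A ^ 2] is the adjoint of [J] times [J], that is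
    [A ^ 2 = |J| ^ 2] ([abs_jacobiP]).  As [A (delta n)] is a combination of
    [delta n.-1], [delta n] and [delta n.+1] with nonzero last coefficient
    [a n], the orbit [A ^ n (delta 0)] is total ([conj_jacobi_total]).  The
    three conclusions hold for every positive [T] for which there are such an
    [A] with [A ^ 2 = T ^ 2] and a vector [u] with a total [A]-orbit.

    Multiplicity.  The even powers of [A] at [u] are powers of [T] at [u], the
    odd ones are powers of [T] at [A u], so two vectors generate the space under
    [T], and the closed subspace generated by the first one reduces [T]
    ([multiplicity_le2]).

    The two other conclusions have the same core: a projection [P] which
    commutes with [A] and kills [u] kills the [A]-orbit of [u], so it is zero
    ([vanish_of_commute]).

    For the maximal type, [P = E(D)] is a spectral projection of [T].  First,
    [A] commutes with [T]: it commutes with [T ^ 2], and [T] is the limit of an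
    iteration that only involves [T ^ 2] and real scalars ([sqrt_commute]).
    Next, for [c >= 0], [E(]-oo, c])] projects onto the vectors [y] for which
    [|T ^ n y|] is bounded by a multiple of [c ^ n] ([iter_upper],
    [growth_range]), a condition which [A] preserves; as [A] is symmetric for
    the real inner product, it commutes with this projection, and then with
    [E(D)] for every Borel set [D] ([spectral_projection_commute]).

    For the cyclicity of [u] when [T] has some cyclic vector [w], [P] is the
    projection onto the complement of the closed span of the [T ^ n u].  It
    commutes with [T], hence is approximated at [w] by polynomials in [T]; since
    [A] turns a polynomial in [T] into its adjoint when it is moved across, [A]
    commutes with [P] as well ([cyclic_commutant]). *)

Set Implicit Arguments.
Unset Strict Implicit.
Unset Printing Implicit Defensive.

Import Order.TTheory GRing.Theory Num.Theory.
Import numFieldNormedType.Exports.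

Local Open Scope classical_set_scope.
Local Open Scope ring_scope.
Local Open Scope complex_scope.

Local Notation conjC := Num.conj.
Local Notation Re := complex.Re.
Local Notation Im := complex.Im.

(** * The real inner product of a complex Hilbert space *)

Section RealInnerProduct.
Variables (R : realType) (H : hilbertType R).
Implicit Types (x y z : H) (c : R[i]) (r : R).

(** For the real part of the inner product, linear and conjugate-linear
    operators are real-linear alike, and its values live in an ordered field. *)
Definition ip x y : R := Re (hdot x y).

Lemma hdotC x y : hdot x y = conjC (hdot y x).
Proof. by rewrite hermC mul1r. Qed.

Lemma hdotDl x y z : hdot (x + y) z = hdot x z + hdot y z.
Proof. by rewrite linearDl. Qed.
Lemma hdotDr x y z : hdot z (x + y) = hdot z x + hdot z y.
Proof. by rewrite linearDr. Qed.
Lemma hdotBl x y z : hdot (x - y) z = hdot x z - hdot y z.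
Proof. by rewrite linearBl. Qed.
Lemma hdotBr x y z : hdot z (x - y) = hdot z x - hdot z y.
Proof. by rewrite linearBr. Qed.
Lemma hdot0l x : hdot 0 x = 0.
Proof. by rewrite linear0l. Qed.
Lemma hdot0r x : hdot x 0 = 0.
Proof. by rewrite linear0r. Qed.
Lemma hdotZl c x y : hdot (c *: x) y = c * hdot x y.
Proof. by rewrite linearZl_LR. Qed.
Lemma hdotZr c x y : hdot x (c *: y) = conjC c * hdot x y.
Proof. by rewrite linearZr_LR. Qed.

Lemma ReD (z w : R[i]) : Re (z + w) = Re z + Re w.
Proof. by case: z w => [? ?] [? ?]. Qed.
Lemma ReN (z : R[i]) : Re (- z) = - Re z.
Proof. by case: z => [? ?]. Qed.
Lemma ReZ r (z : R[i]) : Re (r%:C * z) = r * Re z.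
Proof. by case: z => [? ?] /=; rewrite mul0r subr0. Qed.

Lemma ipC x y : ip x y = ip y x.
Proof. by rewrite /ip hdotC conjcE. Qed.
Lemma ipDl x y z : ip (x + y) z = ip x z + ip y z.
Proof. by rewrite /ip hdotDl ReD. Qed.
Lemma ipDr x y z : ip z (x + y) = ip z x + ip z y.
Proof. by rewrite /ip hdotDr ReD. Qed.
Lemma ipNl x z : ip (- x) z = - ip x z.
Proof. by rewrite /ip linearNl ReN. Qed.
Lemma ipNr x z : ip z (- x) = - ip z x.
Proof. by rewrite /ip linearNr ReN. Qed.
Lemma ipBl x y z : ip (x - y) z = ip x z - ip y z.
Proof. by rewrite ipDl ipNl. Qed.
Lemma ipBr x y z : ip z (x - y) = ip z x - ip z y.
Proof. by rewrite ipDr ipNr. Qed.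
Lemma ipZl r x z : ip (r%:C *: x) z = r * ip x z.
Proof. by rewrite /ip hdotZl ReZ. Qed.
Lemma ipZr r x z : ip z (r%:C *: x) = r * ip z x.
Proof. by rewrite ipC ipZl ipC. Qed.
Lemma ip0l x : ip 0 x = 0.
Proof. by rewrite /ip linear0l. Qed.
Lemma ip0r x : ip x 0 = 0.
Proof. by rewrite ipC ip0l. Qed.

Definition ipE := (ipDl, ipDr, ipNl, ipNr, ipZl, ipZr).

Lemma hdot_ip x y : hdot x y = ip x y +i* ip x ('i *: y).
Proof.
rewrite /ip hdotZr conjcE/=; case: (hdot x y) => a b /=.
by rewrite mul0r sub0r mulN1r opprK.
Qed.

Lemma hdotxx x : hdot x x = (ip x x)%:C.
Proof.
have := congr1 (@complex.Im R) (hdotC x x); rewrite conjcE/= /ip.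
by case: (hdot x x) => a b /= h; congr (_ +i* _); lra.
Qed.

Lemma ip_ge0 x : 0 <= ip x x.
Proof.
by have := dnorm_ge0 (hdot (s := H)) x; rewrite hdotxx lecE => /andP[].
Qed.

Lemma sqr_hnorm x : hnorm x ^+ 2 = ip x x.
Proof. by rewrite /hnorm sqr_dot_norm. Qed.

Lemma hnorm_ge0 x : 0 <= hnorm x.
Proof. exact: dot_norm_ge0. Qed.

Lemma ip_eq0 x : ip x x = 0 -> x = 0.
Proof.
by move=> x0; apply/eqP; rewrite -(dnorm_eq0 (hdot (s := H))) hdotxx x0.
Qed.

Lemma hnorm_eq0 x : hnorm x = 0 -> x = 0.
Proof. by move=> x0; apply: ip_eq0; rewrite -sqr_hnorm x0 expr0n. Qed.

Lemma hnorm0 : hnorm (0 : H) = 0.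
Proof. by apply/eqP; rewrite -sqrf_eq0 sqr_hnorm ip0l. Qed.

Lemma hnorm_le x r : 0 <= r -> ip x x <= r ^+ 2 -> hnorm x <= r.
Proof.
by move=> r0; rewrite -sqr_hnorm ler_pXn2r ?nnegrE ?hnorm_ge0.
Qed.

Lemma hnorm_opp x : hnorm (- x) = hnorm x.
Proof.
apply/eqP; rewrite -(@eqrXn2 _ 2) ?hnorm_ge0// !sqr_hnorm.
by rewrite ipNl ipNr opprK.
Qed.

Lemma hnorm_distC x y : hnorm (x - y) = hnorm (y - x).
Proof. by rewrite -hnorm_opp opprB. Qed.

Lemma hnorm_scale r x : hnorm (r%:C *: x) = `|r| * hnorm x.
Proof.
apply/eqP; rewrite -(@eqrXn2 _ 2) ?mulr_ge0 ?hnorm_ge0//.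
by rewrite exprMn !sqr_hnorm ipZl ipZr mulrA real_normK ?num_real// expr2.
Qed.

(** Evaluate the polynomial at its vertex or, when the leading coefficient
    vanishes, at the point where a nonconstant affine function is [-1]. *)
Lemma sqr_discr_le (p q s : R) : 0 <= s ->
  (forall t, 0 <= p + t * q *+ 2 + t ^+ 2 * s) -> q ^+ 2 <= p * s.
Proof.
rewrite le_eqVlt => /predU1P[<-|s0] h.
  rewrite mulr0; have [->|q0] := eqVneq q 0; first by rewrite expr0n.
  have := h (- (p + 1) / (q * 2)); rewrite mulr0 addr0.
  have -> : p + - (p + 1) / (q * 2) * q *+ 2 = -1 by field.
  lra.
have := h (- q / s).
have -> : p + - q / s * q *+ 2 + (- q / s) ^+ 2 * s = (p * s - q ^+ 2) / s.
  by field; rewrite gt_eqF.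
by rewrite pmulr_lge0 ?invr_gt0// subr_ge0.
Qed.

(** The form [f] may be degenerate, so that the inequality also applies to
    [<T x, y>] for a positive operator [T]. *)
Lemma form_cauchy_schwarz (f : H -> H -> R) :
  (forall x y, f x y = f y x) -> (forall x y z, f (x + y) z = f x z + f y z) ->
  (forall r x z, f (r%:C *: x) z = r * f x z) -> (forall x, 0 <= f x x) ->
  forall x y, f x y ^+ 2 <= f x x * f y y.
Proof.
move=> fC fD fZ f0 x y; apply: sqr_discr_le => // t.
have := f0 (x + t%:C *: y).
rewrite fD fZ (fC x (_ + _)) (fC y (_ + _)) !fD !fZ (fC y x).
by congr (_ <= _); ring.
Qed.

Lemma ip_le x y : ip x y <= hnorm x * hnorm y.
Proof.
have [xy|xy] := lerP (ip x y) 0.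
  by rewrite (le_trans xy)// mulr_ge0 ?hnorm_ge0.
rewrite -(@ler_pXn2r _ 2) ?nnegrE ?mulr_ge0 ?hnorm_ge0 ?(ltW xy)// exprMn.
rewrite !sqr_hnorm; exact: (form_cauchy_schwarz ipC ipDl ipZl ip_ge0).
Qed.

Lemma ip_abs_le x y : `|ip x y| <= hnorm x * hnorm y.
Proof.
by rewrite ler_norml ip_le andbT lerNl -ipNl -[hnorm x]hnorm_opp ip_le.
Qed.

Lemma hnorm_add_le x y : hnorm (x + y) <= hnorm x + hnorm y.
Proof.
apply: hnorm_le; first by rewrite addr_ge0 ?hnorm_ge0.
rewrite sqrrD !sqr_hnorm !ipE [ip y x]ipC.
have := ip_le x y; lra.
Qed.

Lemma hnorm_triangle z x y : hnorm (x - y) <= hnorm (x - z) + hnorm (z - y).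
Proof. by have := hnorm_add_le (x - z) (z - y); rewrite addrA subrK. Qed.

(** The imaginary part of an inner product is a real part again, with ['i]
    moved into one argument; orthogonality is therefore two real equations. *)
Lemma hdotxi x y : hdot x y = 0 <-> ip x y = 0 /\ ip x ('i *: y) = 0.
Proof. by rewrite hdot_ip; split=> [[-> ->]|[-> ->]]. Qed.

Lemma hdotixl x y : hdot x y = 0 <-> ip x y = 0 /\ ip ('i *: x) y = 0.
Proof.
rewrite /ip hdotZl; case: (hdot x y) => a b /=.
rewrite mul0r sub0r mul1r; split=> [[-> ->]|[-> /eqP]]; first by rewrite oppr0.
by rewrite oppr_eq0 => /eqP ->.
Qed.

Lemma ip_inj x y : (forall z, ip x z = ip y z) -> x = y.
Proof.
move=> xy; apply/eqP; rewrite -subr_eq0; apply/eqP/ip_eq0.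
by rewrite ipBl xy subrr.
Qed.

Lemma ip_hdot_eq x y x' y' :
  ip x y = ip x' y' -> ip x ('i *: y) = ip x' ('i *: y') ->
  hdot x y = hdot x' y'.
Proof. by rewrite !hdot_ip => -> ->. Qed.

End RealInnerProduct.

(** * Convergence and closed spans *)

Section HilbertConvergence.
Variables (R : realType) (H : hilbertType R).
Implicit Types (x y z l : H) (u v : nat -> H).

Definition hcvg u l : Prop := (fun n => hnorm (u n - l)) @ \oo --> (0 : R).

Lemma cvg0_le (f g : nat -> R) : (forall n, 0 <= f n <= g n) ->
  g @ \oo --> (0 : R) -> f @ \oo --> (0 : R).
Proof.
move=> fg g0; apply: (squeeze_cvgr _ (cvg_cst 0) g0).
by near=> n; exact: fg.
Unshelve. all: by end_near. Qed.

Lemma hcvg_le u l (f : nat -> R) : (forall n, hnorm (u n - l) <= f n) ->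
  f @ \oo --> (0 : R) -> hcvg u l.
Proof. by move=> uf; apply: cvg0_le => n; rewrite hnorm_ge0 uf. Qed.

Lemma hcvg_cauchy u (f : nat -> R) :
  (forall m n, (n <= m)%N -> hnorm (u m - u n) <= f n) ->
  f @ \oo --> (0 : R) -> exists l, hcvg u l.
Proof.
move=> uf f0; apply: (hilbert_complete (s := H)) => e e0.
have /cvgrPdist_lt/(_ _ e0)[N _ fN] := f0.
have {}fN n : (N <= n)%N -> f n < e.
  by move=> /fN /=; rewrite sub0r normrN; exact: le_lt_trans (ler_norm _).
exists N => m n Nm Nn; change (hnorm (u m - u n) < e).
have [nm|/ltnW mn] := leqP n m; first exact: le_lt_trans (uf _ _ nm) (fN _ Nn).
by rewrite hnorm_distC (le_lt_trans (uf _ _ mn))// fN.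
Qed.


Lemma cvg0_mulr (f : nat -> R) (r : R) :
  f @ \oo --> (0 : R) -> (fun n => f n * r) @ \oo --> (0 : R).
Proof.
move=> f0; rewrite -[X in _ --> X](mul0r r).
by apply: cvgM => //; exact: cvg_cst.
Qed.

Lemma cvg0_sqrt (f : nat -> R) :
  f @ \oo --> (0 : R) -> (fun n => Num.sqrt (f n)) @ \oo --> (0 : R).
Proof.
move=> f0; rewrite -[X in _ --> X]sqrtr0.
by apply: continuous_cvg => //; exact: sqrt_continuous.
Qed.

Lemma hcvg_cst x : hcvg (fun=> x) x.
Proof. by rewrite /hcvg subrr hnorm0; exact: cvg_cst. Qed.

Lemma hcvg_ip u l y : hcvg u l -> (fun n => ip (u n) y) @ \oo --> ip l y.
Proof.
move=> ul; apply/subr_cvg0; apply/norm_cvg0P.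
apply: (@cvg0_le _ (fun n => hnorm (u n - l) * hnorm y)) => [n|].
  by rewrite normr_ge0/= -ipBl ip_abs_le.
exact: cvg0_mulr.
Qed.

Arguments hcvg_ip {u l} y.

Lemma hcvgD u v x y : hcvg u x -> hcvg v y -> hcvg (fun n => u n + v n) (x + y).
Proof.
move=> ux vy.
apply: (@hcvg_le _ _ (fun n => hnorm (u n - x) + hnorm (v n - y))).
  by move=> n; rewrite opprD addrACA hnorm_add_le.
by rewrite -[X in _ --> X](addr0 0); apply: cvgD.
Qed.

Lemma hcvg_unique u x y : hcvg u x -> hcvg u y -> x = y.
Proof.
move=> ux uy; apply: ip_inj => z.
have := hcvg_ip z uy; exact: (cvg_unique _ (hcvg_ip z ux)).
Qed.

Lemma hcvg_norm_le u l (r : R) : (forall n, hnorm (u n) <= r) -> hcvg u l ->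
  hnorm l <= r.
Proof.
move=> ur ul; have [->|l0] := eqVneq (hnorm l) 0.
  exact: le_trans (hnorm_ge0 _) (ur 0%N).
have hl : 0 < hnorm l by rewrite lt_neqAle eq_sym l0 hnorm_ge0.
have c := hcvg_ip l ul.
rewrite -(ler_pM2r hl) -expr2 sqr_hnorm -(cvg_lim _ c)//.
apply: limr_le; first exact: cvgP c.
by near=> n; apply: le_trans (ip_le _ _) _; rewrite ler_wpM2r ?hnorm_ge0.
Unshelve. all: by end_near. Qed.

Lemma linear_scale (T : H -> H) c x : linear T -> T (c *: x) = c *: T x.
Proof.
move=> Tlin; have T0 : T 0 = 0.
  have /eqP := Tlin 1 0 0.
  by rewrite scaler0 addr0 scale1r -subr_eq subrr => /eqP.
by have := Tlin c x 0; rewrite T0 !addr0.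
Qed.

(** Homogeneity over the reals only, so that linear and conjugate-linear
    operators are treated at once. *)
Definition real_bounded (A : H -> H) : Prop :=
  [/\ forall x y, A (x + y) = A x + A y,
      forall (r : R) x, A (r%:C *: x) = r%:C *: A x
    & exists M : R, forall x, hnorm (A x) <= M * hnorm x].

Lemma bounded_op_real T : bounded_op T -> real_bounded T.
Proof.
move=> [Tlin Tb]; split=> //.
  by move=> x y; have := Tlin 1 x y; rewrite !scale1r.
by move=> r x; exact: linear_scale.
Qed.

Lemma real_boundedB A x y : real_bounded A -> A (x - y) = A x - A y.
Proof.
move=> [AD AZ _]; rewrite AD; congr (_ + _).
by rewrite -scaleN1r -[RHS]scaleN1r -(rmorphN1 (real_complex R)) AZ.
Qed.

Lemma real_bounded0 A : real_bounded A -> A 0 = 0.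
Proof. by move=> rA; have := real_boundedB 0 0 rA; rewrite !subrr. Qed.

Lemma real_bounded_ge0 A : real_bounded A ->
  exists2 M : R, 0 <= M & forall x, hnorm (A x) <= M * hnorm x.
Proof.
move=> [_ _ [M AM]]; exists `|M| => // x; apply: le_trans (AM x) _.
by rewrite ler_wpM2r ?hnorm_ge0 ?ler_norm.
Qed.

Lemma hcvg_app A u l : real_bounded A -> hcvg u l -> hcvg (A \o u) (A l).
Proof.
move=> rA ul; have [_ _ [M AM]] := rA.
apply: (@hcvg_le _ _ (fun n => hnorm (u n - l) * M)); last exact: cvg0_mulr.
by move=> n; rewrite /= -real_boundedB// mulrC.
Qed.

Lemma bounded_scale c : bounded_op (fun x : H => c *: x).
Proof.
split; first by move=> a x y; rewrite scalerDr !scalerA mulrC.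
exists (Num.sqrt (sqabs c)) => x; apply: hnorm_le.
  by rewrite mulr_ge0 ?sqrtr_ge0 ?hnorm_ge0.
rewrite exprMn sqr_sqrtr ?sqabs_ge0// sqr_hnorm /ip hdotZl hdotZr mulrA -normCK.
rewrite hdotxx /sqabs; case: (`|c| ^+ 2) => a b /=; lra.
Qed.

Lemma hcvgZ c u l : hcvg u l -> hcvg (fun n => c *: u n) (c *: l).
Proof. exact: hcvg_app (bounded_op_real (bounded_scale c)). Qed.

Lemma half_scale x : 2^-1%:C *: (x + x) = x.
Proof.
rewrite scalerDr -scalerDl -rmorphD/=.
have -> : 2^-1 + 2^-1 = 1 :> R by lra.
exact: scale1r.
Qed.

Definition submodule (S : H -> Prop) : Prop :=
  S 0 /\ forall c x y, S x -> S y -> S (c *: x + y).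

(** Sequences suffice for closures in a metric space, and they are what
    bounded operators transport. *)
Definition hclosure (S : H -> Prop) x : Prop :=
  exists2 u, (forall n, S (u n)) & hcvg u x.

Definition in_span (v : nat -> H) x : Prop :=
  exists (n : nat) (c : nat -> R[i]), x = \sum_(m < n) c m *: v m.

Lemma submodule_span v : submodule (in_span v).
Proof.
split; first by exists 0%N, (fun=> 0); rewrite big_ord0.
move=> c x y [n [a ->]] [m [b ->]]; exists (n + m)%N.
exists (fun k => c * (if (k < n)%N then a k else 0) +
  (if (k < m)%N then b k else 0)).
have pad (p q : nat) (d : nat -> R[i]) : (p <= q)%N ->
    \sum_(k < p) d k *: v k =
    \sum_(k < q) (if (k < p)%N then d k else 0) *: v k.
  move=> pq; rewrite (big_ord_widen q (fun k => d k *: v k))// big_mkcond/=.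
  by apply: eq_bigr => k _; case: ifP; rewrite ?scale0r.
rewrite (pad n (n + m)%N) ?leq_addr// (pad m (n + m)%N) ?leq_addl//.
rewrite scaler_sumr -big_split; apply: eq_bigr => k _.
by rewrite /= scalerDl scalerA.
Qed.

Lemma span_mem v n : in_span v (v n).
Proof.
exists n.+1, (fun k => (k == n)%:R); rewrite big_ord_recr/= eqxx scale1r.
by rewrite big1 ?add0r// => k _; rewrite ltn_eqF// scale0r.
Qed.

Lemma span_min v (S : H -> Prop) : submodule S -> (forall n, S (v n)) ->
  forall x, in_span v x -> S x.
Proof.
move=> [S0 SP] Sv x [n [c ->]]; elim: n => [|n ih]; first by rewrite big_ord0.
by rewrite big_ord_recr/= addrC; apply: SP.
Qed.

Lemma submodule_closure S : submodule S -> submodule (hclosure S).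
Proof.
move=> [S0 SP]; split.
  by exists (fun=> 0) => //; exact: hcvg_cst.
move=> c x y [u Su ux] [v Sv vy]; exists (fun n => c *: u n + v n).
  by move=> n; exact: SP.
exact: hcvgD (hcvgZ _ ux) vy.
Qed.

Lemma submodule_orth z : submodule (fun x => hdot x z = 0).
Proof.
split; first by rewrite hdot0l.
by move=> c x y xz yz; rewrite hdotDl hdotZl xz yz mulr0 addr0.
Qed.

Lemma closure_orth S z : (forall x, S x -> hdot x z = 0) ->
  forall x, hclosure S x -> hdot x z = 0.
Proof.
move=> Sz x [u Su ux]; have h w : (forall n, ip (u n) w = 0) -> ip x w = 0.
  move=> uw; have := hcvg_ip w ux.
  by under eq_fun do rewrite uw; move/cvg_lim => <- //; rewrite lim_cst.
by apply/hdotxi; split; apply: h => n; have /hdotxi[] := Sz _ (Su n).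
Qed.

(** Two approximate minimizers of the distance to [x] are close to each other,
    by the parallelogram law, and [x] minus an approximate minimizer is almost
    orthogonal to [S]: the discriminant of [t |-> |x - s - t y| ^ 2] bounds the
    squared inner product by the defect times [|y| ^ 2]. *)
Lemma nearest_point S x : submodule S ->
  exists2 p, hclosure S p & forall s, S s -> hdot s (x - p) = 0.
Proof.
move=> [S0 SP].
pose D := [set r | exists2 s, S s & r = ip (x - s) (x - s)].
have lbD : has_lbound D by exists 0 => _ [s _ ->]; exact: ip_ge0.
have infD : has_inf D by split=> //; exists (ip (x - 0) (x - 0)); exists 0.
pose d := inf D.
have dle s : S s -> d <= ip (x - s) (x - s).
  by move=> Ss; apply: ge_inf => //; exists s.
have /choice[s sP] n : exists s, S s /\ ip (x - s) (x - s) < d + n.+1%:R^-1.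
  have n0 : 0 < n.+1%:R^-1 :> R by rewrite invr_gt0 ltr0n.
  by have [_ [s Ss ->] ds] := inf_adherent n0 infD; exists s.
have SB y z : S y -> S z -> S (2^-1%:C *: (y + z)).
  move=> Sy Sz; rewrite scalerDr -[X in _ + X]addr0; apply: (SP) => //.
  exact: SP.
have diag m n : (n <= m)%N -> hnorm (s m - s n) <= Num.sqrt (4 * n.+1%:R^-1).
  move=> nm; apply: hnorm_le; first exact: sqrtr_ge0.
  rewrite sqr_sqrtr ?mulr_ge0//; have [Sm m1] := sP m; have [Sn n1] := sP n.
  have := dle _ (SB _ _ Sm Sn).
  have mn : m.+1%:R^-1 <= n.+1%:R^-1 :> R.
    by rewrite lef_pV2 ?posrE ?ltr0n// ler_nat.
  have -> : s m - s n = (x - s n) - (x - s m).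
    by rewrite opprB [RHS]addrC addrA subrK.
  have -> : x - 2^-1%:C *: (s m + s n) = 2^-1%:C *: ((x - s n) + (x - s m)).
    by rewrite addrACA -opprD scalerBr half_scale [s n + _]addrC.
  move: (x - s m) (x - s n) (m.+1%:R^-1) (n.+1%:R^-1) m1 n1 mn => y z p q.
  rewrite !ipE (ipC z y); lra.
have c0 : (fun n => n.+1%:R^-1) @ \oo --> (0 : R) by exact: cvg_harmonic.
have sc0 r : (fun n => Num.sqrt (r * n.+1%:R^-1)) @ \oo --> (0 : R).
  apply: cvg0_sqrt; rewrite -[X in _ --> X](mulr0 r).
  by apply: cvgM => //; exact: cvg_cst.
have [p sp] := hcvg_cauchy diag (sc0 _).
exists p; first by exists s => // n; exact: (sP n).1.
have orth y : S y -> ip (x - p) y = 0.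
  move=> Sy; have xsp : hcvg (fun n => x - s n) (x - p).
    under eq_fun do rewrite -scaleN1r; rewrite -[- p]scaleN1r.
    exact: hcvgD (hcvg_cst x) (hcvgZ _ sp).
  have h := hcvg_ip y xsp; apply/esym/(cvg_unique _ _ h) => //.
  apply/norm_cvg0P/(@cvg0_le _ _ _ (sc0 (ip y y))) => n.
  rewrite normr_ge0/= -sqrtr_sqr ler_sqrt ?mulr_ge0 ?ip_ge0// mulrC.
  have [Sn n1] := sP n.
  apply: sqr_discr_le => [|t]; first exact: ip_ge0.
  have := dle _ (SP (- t%:C) _ _ Sy Sn).
  have -> : x - (- t%:C *: y + s n) = (x - s n) + t%:C *: y.
    by rewrite opprD scaleNr opprK addrA addrAC.
  move: (x - s n) (n.+1%:R^-1) n1 => z r; rewrite !ipE (ipC y z) expr2; lra.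
move=> y Sy; apply/hdotixl; rewrite ipC orth// ipC orth//.
by rewrite -[_ *: _]addr0; apply: SP.
Qed.

End HilbertConvergence.
Arguments hcvg_ip {R H u l} y _.

(** * Orthogonal projections *)

Section OrthogonalProjections.
Variables (R : realType) (H : hilbertType R).
Implicit Types (x y z : H) (P T : H -> H).

Lemma self_adjoint_ip T x y : self_adjoint T -> ip (T x) y = ip x (T y).
Proof. by rewrite /ip => ->. Qed.

Lemma op_projB P x y : orthogonal_projection P -> P (x - y) = P x - P y.
Proof. by move=> [/bounded_op_real Pb _ _]; rewrite real_boundedB. Qed.

Lemma op_proj0 P : orthogonal_projection P -> P 0 = 0.
Proof. by move=> [/bounded_op_real Pb _ _]; rewrite real_bounded0. Qed.

Lemma proj_ip P x : orthogonal_projection P -> ip (P x) x = ip (P x) (P x).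
Proof. by move=> [_ Psa PP]; rewrite [RHS]self_adjoint_ip// PP ipC. Qed.

Lemma proj_pythagoras P x : orthogonal_projection P ->
  ip (x - P x) (x - P x) = ip x x - ip (P x) (P x).
Proof. by move=> oP; rewrite !ipE (ipC x (P x)) proj_ip//; ring. Qed.

Lemma proj_le P x : orthogonal_projection P -> hnorm (P x) <= hnorm x.
Proof.
move=> oP; apply: hnorm_le; first exact: hnorm_ge0.
by rewrite sqr_hnorm -subr_ge0 -proj_pythagoras// ip_ge0.
Qed.

Lemma projection_compl P : orthogonal_projection P ->
  orthogonal_projection (fun x => x - P x).
Proof.
move=> oP; have [[Plin _] Psa PP] := oP; split; first split.
- move=> c x y; rewrite Plin scalerBr opprD; exact: addrACA.
- exists 1 => x; rewrite mul1r; apply: hnorm_le; first exact: hnorm_ge0.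
  by rewrite sqr_hnorm proj_pythagoras// gerBl ip_ge0.
- by move=> x y; rewrite hdotBl hdotBr Psa.
by move=> x; rewrite op_projB// PP subrr subr0.
Qed.

(** A bounded self-adjoint operator which preserves the span of [v] preserves
    both its closure and its orthogonal complement, hence commutes with the
    projection onto the closure. *)
Lemma span_projection (v : nat -> H) : exists P,
  [/\ orthogonal_projection P,
      forall n, P (v n) = v n,
      forall x, (forall n, hdot (v n) x = 0) -> P x = 0
    & forall T, bounded_op T -> self_adjoint T ->
        (forall n, in_span v (T (v n))) -> forall x, P (T x) = T (P x)].
Proof.
have subS := submodule_span v.
have [cl0 clP] := submodule_closure subS.
have /choice[P PP] x : exists p, hclosure (in_span v) p /\
    forall n, hdot (v n) (x - p) = 0.
  have [p clp xp] := nearest_point x subS.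
  by exists p; split=> // n; apply: xp; exact: span_mem.
have clorth x z : (forall n, hdot (v n) z = 0) -> hclosure (in_span v) x ->
    hdot x z = 0.
  move=> vz; apply: closure_orth.
  exact: (span_min (submodule_orth z) vz).
have uniq x q : hclosure (in_span v) q -> (forall n, hdot (v n) (x - q) = 0) ->
    P x = q.
  move=> clq xq; have [clp xp] := PP x.
  apply/eqP; rewrite -subr_eq0; apply/eqP/ip_eq0; rewrite /ip clorth//.
    move=> n; have -> : P x - q = (x - q) - (x - P x).
      by rewrite opprB [RHS]addrC addrA subrK.
    by rewrite hdotBr xq xp subrr.
  by rewrite addrC -scaleN1r; exact: clP.
have clv x : in_span v x -> hclosure (in_span v) x.
  by move=> vx; exists (fun=> x) => //; exact: hcvg_cst.
have Plin : linear P.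
  move=> c x y; have [[clx xP] [cly yP]] := (PP x, PP y); apply: uniq.
    exact: clP.
  move=> n; rewrite opprD addrACA -scalerBr hdotDr hdotZr xP yP.
  by rewrite mulr0 addr0.
have orth x y : hdot (P x) y = hdot (P x) (P y).
  apply/eqP; rewrite -subr_eq0 -hdotBr; apply/eqP.
  by apply: clorth; [exact: (PP y).2|exact: (PP x).1].
have Psa : self_adjoint P.
  by move=> x y; rewrite orth hdotC -orth -hdotC.
have idem x : P (P x) = P x.
  by apply: uniq => [|n]; [exact: (PP x).1|rewrite subrr hdot0r].
exists P; split.
- split=> //; split=> //; exists 1 => x; rewrite mul1r.
  apply: hnorm_le; first exact: hnorm_ge0.
  rewrite sqr_hnorm -subr_ge0.
  have -> : ip x x - ip (P x) (P x) = ip (x - P x) (x - P x).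
    have o : ip (P x) x = ip (P x) (P x) by rewrite /ip orth.
    by rewrite !ipE (ipC x (P x)) o; ring.
  exact: ip_ge0.
- move=> n; apply: uniq => [|m]; last by rewrite subrr hdot0r.
  by apply: clv; exact: span_mem.
- by move=> x xv; apply: uniq => // n; rewrite subr0.
move=> T Tb Tsa Tv x; have rT := bounded_op_real Tb; apply: uniq.
  have [u uS ux] := (PP x).1; exists (T \o u); last exact: hcvg_app.
  move=> n /=; have [S0 SP] := subS.
  have : submodule (fun y => in_span v (T y)).
    split; first by rewrite real_bounded0.
    by move=> c y z; rewrite Tb.1; exact: SP.
  by move/span_min; apply.
move=> n; rewrite -real_boundedB// -Tsa.
by apply: (clorth _ _ (PP x).2); apply: clv.
Qed.

(** A closed span with trivial orthogonal complement is the whole space; this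
    and its converse let cyclicity be tested by inner products alone. *)
Lemma cyclic_of_total T w :
  (forall z, (forall n, hdot (iter n T w) z = 0) -> z = 0) -> cyclic_vector T w.
Proof.
move=> tot x e e0.
have [p [u uS up] xp] := nearest_point x (submodule_span (fun n => iter n T w)).
have px : x = p.
  apply/eqP; rewrite -subr_eq0; apply/eqP/tot => n; apply: xp; exact: span_mem.
have /cvgr0Pnorm_lt/(_ _ e0)[N _ uN] := up.
have [n [c uE]] := uS N; exists n, c; rewrite -uE px hnorm_distC.
by have := uN N (leqnn N); rewrite /= ger0_norm ?hnorm_ge0.
Qed.

Lemma total_of_cyclic T w : cyclic_vector T w ->
  forall z, (forall n, hdot (iter n T w) z = 0) -> z = 0.
Proof.
move=> cyc z wz; apply: hnorm_eq0; apply/eqP; rewrite eq_le hnorm_ge0 andbT.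
apply/ler_addgt0Pr => e e0; rewrite add0r.
have [n [c zc]] := cyc z e e0.
have zE : ip z (z - \sum_(m < n) c m *: iter m T w) = ip z z.
  rewrite ipBr [X in _ - X](_ : _ = 0) ?subr0// /ip linear_sumr big1//= => m _.
  by rewrite hdotZr hdotC wz conjC0 mulr0.
have [->|z0] := eqVneq (hnorm z) 0; first exact: ltW.
have hz : 0 < hnorm z by rewrite lt_neqAle eq_sym z0 hnorm_ge0.
rewrite -(ler_pM2l hz) -expr2 sqr_hnorm -zE.
by apply: le_trans (ip_le _ _) _; rewrite ler_pM2l// ltW.
Qed.

End OrthogonalProjections.

(** * Splitting along a cyclic subspace *)

Section ProjectionRange.
Variables (R : realType) (H : hilbertType R).

(** Ranges of projections are closed subspaces that depend on a single term,
    which makes them usable as an indexed family of Hilbert spaces. *)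
Record oproj := OProj {
  oproj_fun :> H -> H;
  oprojP : orthogonal_projection oproj_fun
}.

Variable P : oproj.

Definition range_pred : {pred H} := fun x => P x == x.

Lemma range_submod_closed : submod_closed range_pred.
Proof.
have [[Plin _] _ _] := oprojP P.
split; first by rewrite unfold_in op_proj0//; exact: oprojP.
by move=> c x y; rewrite !unfold_in => /eqP Px /eqP Py; rewrite Plin Px Py.
Qed.

HB.instance Definition _ :=
  GRing.isSubmodClosed.Build R[i] H range_pred range_submod_closed.

Record proj_range : Type := ProjRange {
  range_val :> H;
  range_valP : range_val \in range_pred
}.

HB.instance Definition _ := [isSub for range_val].
HB.instance Definition _ := [Choice of proj_range by <:].
HB.instance Definition _ := [SubChoice_isSubLmodule of proj_range by <:].

Definition range_dot (x y : proj_range) : R[i] := hdot (x : H) (y : H).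

Lemma range_dotP z (x y w : proj_range) :
  range_dot (z *: x + y) w = z * range_dot x w + range_dot y w.
Proof. by rewrite /range_dot -hdotZl -hdotDl. Qed.

Lemma range_dotC (x y : proj_range) : range_dot x y = conjC (range_dot y x).
Proof. exact: hdotC. Qed.

Lemma range_dot_gt0 (x : proj_range) : x != 0 -> 0 < range_dot x x.
Proof. by move=> x0; rewrite /range_dot dnorm_gt0. Qed.

HB.instance Definition _ := bilinear_isBilinear.Build R[i] proj_range proj_range
  R[i] _ _ range_dot (dot_bilinear_for range_dotP range_dotC).
HB.instance Definition _ := isHermitianSesquilinear.Build R[i] proj_range false
  conjC range_dot (dot_hermitian range_dotC).
HB.instance Definition _ := isDotProduct.Build R[i] proj_range range_dot
  range_dot_gt0.

Lemma range_complete : dot_complete range_dot.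
Proof.
move=> u cu; have [l ul] := hilbert_complete (s := H) (fun n => u n : H) cu.
have Pr := bounded_op_real (let: And3 Pb _ _ := oprojP P in Pb).
have Pl : P l = l.
  apply: hcvg_unique (ul); have := hcvg_app Pr ul.
  rewrite (_ : _ \o _ = (fun n => u n : H))//.
  by apply/funext => n /=; exact/eqP/(range_valP (u n)).
have lP : l \in range_pred by rewrite unfold_in Pl.
by exists (ProjRange lP).
Qed.

HB.instance Definition _ := Lmodule_isHilbert.Build R proj_range range_complete.

Definition to_range (x : H) : proj_range := insubd (0 : proj_range) (P x).

Lemma to_rangeE x : to_range x = P x :> H.
Proof.
have [_ _ PP] := oprojP P.
by rewrite /to_range val_insubd unfold_in PP eqxx.
Qed.

Lemma range_fix (x : proj_range) : P x = x.
Proof. exact/eqP/(range_valP x). Qed.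

(** The compression of [T], so that it is defined even if [T] does not
    preserve the range; it is the restriction of [T] when [P] and [T]
    commute. *)
Definition range_op (T : H -> H) (x : proj_range) : proj_range :=
  to_range (T x).

Lemma bounded_range_op T : bounded_op T -> bounded_op (range_op T).
Proof.
move=> [Tlin [M TM]]; have [[Plin _] _ _] := oprojP P; split.
  by move=> c x y; apply: val_inj; rewrite /= !to_rangeE /= Tlin Plin.
exists M => x; apply: le_trans (TM x).
change (hnorm (to_range (T x) : H) <= hnorm (T x)).
by rewrite to_rangeE; apply: proj_le; exact: oprojP.
Qed.

Lemma self_adjoint_range_op T : self_adjoint T -> self_adjoint (range_op T).
Proof.
move=> Tsa x y.
change (hdot (to_range (T x) : H) (y : H) = hdot (x : H) (to_range (T y) : H)).
have [_ Psa _] := oprojP P.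
by rewrite !to_rangeE [LHS]Psa -[RHS]Psa !range_fix Tsa.
Qed.

Lemma iter_range_op T w n : (forall x, P (T x) = T (P x)) ->
  iter n (range_op T) (to_range w) = P (iter n T w) :> H.
Proof.
have [_ _ PP] := oprojP P.
move=> PT; elim: n => [|n ih] /=; first exact: to_rangeE.
by rewrite to_rangeE ih PT PP -PT.
Qed.

End ProjectionRange.

Section TwoGenerators.
Variables (R : realType) (H : hilbertType R).
Implicit Types (T : H -> H).

Lemma in_span_iter T u n : in_span (fun m => iter m T u) (T (iter n T u)).
Proof. exact: (span_mem (fun m => iter m T u) n.+1). Qed.

(** Let [P] be the projection onto the closed span of the [T ^ n u].  It reduces
    [T], and [u] is cyclic in its range by construction.  In the range of
    [1 - P], the vector [v - P v] is cyclic: what is orthogonal there to its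
    orbit is orthogonal to the orbit of [v], and also to that of [u]. *)
Lemma multiplicity_le2 T u v : bounded_op T -> self_adjoint T ->
  (forall z, (forall n, hdot (iter n T u) z = 0) ->
             (forall n, hdot (iter n T v) z = 0) -> z = 0) ->
  multiplicity_le T 2.
Proof.
move=> Tb Tsa tot.
have [P [oP Pu Pz PT]] := span_projection (fun n => iter n T u).
have {}PT x : P (T x) = T (P x) by apply: PT => // n; exact: in_span_iter.
pose Q (i : 'I_2) : oproj H :=
  if i == 0 then OProj oP else OProj (projection_compl oP).
have QT i x : Q i (T x) = T (Q i x).
  rewrite /Q; case: ifP => _ /=; first exact: PT.
  by rewrite PT real_boundedB//; exact: bounded_op_real.
have Qsum x : x = Q 0 x + Q 1 x by rewrite /Q/= addrC subrK.
have Qorth x y : hdot (Q 0 x) (Q 1 y) = 0.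
  have [_ Psa PP] := oP.
  by rewrite /Q/= Psa op_projB// PP subrr hdot0r.
exists 2%N, (fun i => proj_range (Q i)), (fun i => range_op (P := Q i) T).
split=> //.
  move=> i; split; [exact: bounded_range_op|exact: self_adjoint_range_op|].
  exists (to_range (Q i) (if i == 0 then u else v)).
  apply: cyclic_of_total => z wz.
  have {}wz n : hdot (iter n T (if i == 0 then u else v)) (z : H) = 0.
    rewrite -(range_fix z); have [_ Qsa _] := oprojP (Q i).
    by rewrite -Qsa -iter_range_op//; exact: wz.
  apply: val_inj => /=; move: (range_fix z) wz; move: (z : H) => {z} x.
  rewrite /Q; case: ifP => _ /= xi wx; first by rewrite -xi Pz.
  have Px : P x = 0.
    by rewrite -(subKr x (P x)) xi subrr.
  have [_ Psa _] := oP.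
  by apply: tot => // n; rewrite -Pu Psa Px hdot0r.
exists (fun x i => to_range (Q i) x); last first.
  move=> x; apply: functional_extensionality_dep => i; apply: val_inj.
  have [_ _ QQ] := oprojP (Q i).
  change (to_range (Q i) (T x) =
    to_range (Q i) (T (to_range (Q i) x : H)) :> H).
  by rewrite !to_rangeE -(QT i x) QQ.
split.
- move=> c x y; apply: functional_extensionality_dep => i; apply: val_inj.
  rewrite /= !to_rangeE /=; have [[Qlin _] _ _] := oprojP (Q i).
  exact: Qlin.
- move=> y; exists ((y 0 : H) + (y 1 : H)).
  have P0 : P (y 0) = y 0 :> H := range_fix (y 0).
  have P1 : P (y 1) = 0.
    have y1 : (y 1 : H) - P (y 1) = y 1 :> H := range_fix (y 1).
    by rewrite -(subKr (y 1 : H) (P _)) y1 subrr.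
  have PD : P ((y 0 : H) + (y 1 : H)) = y 0 :> H.
    by have [-> _ _] := bounded_op_real (let: And3 b _ _ := oP in b);
       rewrite P0 P1 addr0.
  apply: functional_extensionality_dep => i; apply: val_inj.
  rewrite /= to_rangeE.
  have [->|->] : i = 0 \/ i = 1.
  + by case: i => [[|[|//]]] hi; [left|right]; apply: val_inj.
  + by rewrite /Q/= PD.
  + by rewrite /Q/= PD addrC addKr.
move=> x y.
change (\sum_i hdot (to_range (Q i) x : H) (to_range (Q i) y : H) = hdot x y).
rewrite big_ord_recl big_ord1 !to_rangeE.
rewrite (_ : lift _ _ = 1); last exact: val_inj.
rewrite (_ : ord0 = 0); last exact: val_inj.
have o1 := Qorth x y; have o2 : hdot (Q 1 x) (Q 0 y) = 0.
  by rewrite hdotC Qorth conjC0.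
rewrite [in RHS](Qsum x) [in RHS](Qsum y).
move: (Q 0 x) (Q 0 y) (Q 1 x) (Q 1 y) o1 o2 => p q r s ps rq.
by rewrite hdotDl !hdotDr ps rq addr0 add0r.
Qed.

End TwoGenerators.

(** * Square roots of positive operators *)

Section PositiveOperators.
Variables (R : realType) (H : hilbertType R).
Implicit Types (x y z : H) (T S G A : H -> H).

Lemma self_adjoint_hdot T x : self_adjoint T -> hdot (T x) x = (ip (T x) x)%:C.
Proof.
move=> Tsa; rewrite hdot_ip; congr (_ +i* _).
have := congr1 (@complex.Im R) (Tsa x x); rewrite [X in _ = Im X]hdotC conjcE.
by rewrite hdot_ip /= => h; lra.
Qed.

Lemma positive_opP T : positive_op T <->
  [/\ bounded_op T, self_adjoint T & forall x, 0 <= ip (T x) x].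
Proof.
split=> -[Tb Tsa T0]; split=> // x; have := T0 x;
  by rewrite self_adjoint_hdot// ler0c.
Qed.

Lemma positive_cauchy_schwarz T x y : positive_op T ->
  ip (T x) y ^+ 2 <= ip (T x) x * ip (T y) y.
Proof.
move=> /positive_opP[/bounded_op_real[TD TZ _] Tsa T0].
apply: (form_cauchy_schwarz (f := fun u v => ip (T u) v)) => //.
- by move=> u v; rewrite self_adjoint_ip// ipC.
- by move=> u v w; rewrite TD ipDl.
- by move=> r u v; rewrite TZ ipZl.
Qed.

(** Cauchy-Schwarz for [<T x, y>] at [y = T x].  This is how bounds on the
    quadratic form in a spectral subspace become bounds on the growth of the
    powers of [T]. *)
Lemma positive_sqr_le T (c : R) x : positive_op T ->
  ip (T (T x)) (T x) <= c * ip (T x) (T x) ->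
  ip (T x) (T x) <= c * ip (T x) x.
Proof.
move=> Tp Tc; have [Tx0|Tx0] := eqVneq (ip (T x) (T x)) 0.
  by rewrite Tx0 (ip_eq0 Tx0) ip0l mulr0.
have Tx : 0 < ip (T x) (T x) by rewrite lt_neqAle eq_sym Tx0 ip_ge0.
have T0 : 0 <= ip (T x) x by have /positive_opP[_ _] := Tp; exact.
rewrite -(ler_pM2r Tx) -expr2 (le_trans (positive_cauchy_schwarz _ _ Tp))//.
by rewrite mulrAC mulrC ler_wpM2r.
Qed.

End PositiveOperators.

Section SquareRootIteration.
Variables (R : realType) (H : hilbertType R) (K : H -> H).
Hypothesis Kb : bounded_op K.
Hypothesis Ksa : self_adjoint K.
Hypothesis K1 : forall x, hnorm (K x) <= hnorm x.

(** The operator [Y = 1 - sqrt (1 - K)] solves [Y = (K + Y ^ 2) / 2], and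
    [sqrt_iter] is the fixed point iteration started at [0].  The scalar
    sequence [sqrt_bound] is the same iteration for [K = 1]; it dominates the
    norms and the increments of the first one, and it is bounded by [1], so
    its convergence forces that of the operators. *)
Fixpoint sqrt_iter n (x : H) : H :=
  if n is m.+1 then 2^-1%:C *: (K x + sqrt_iter m (sqrt_iter m x)) else 0.

Fixpoint sqrt_bound n : R :=
  if n is m.+1 then 2^-1 * (1 + sqrt_bound m ^+ 2) else 0.

Local Notation Y := sqrt_iter.
Local Notation q := sqrt_bound.

Lemma sqrt_bound_itv n : 0 <= q n <= 1.
Proof.
elim: n => [|n /andP[q0 q1]] /=; first by rewrite lexx ler01.
have q2 : q n ^+ 2 <= 1 by rewrite expr_le1.
by have := sqr_ge0 (q n); lra.
Qed.

Lemma sqrt_bound_incr n : q n <= q n.+1.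
Proof. by have := sqr_ge0 (1 - q n); rewrite /= sqrrB; lra. Qed.

Lemma sqrt_bound_mono : {homo q : m n / (m <= n)%N >-> m <= n}.
Proof.
apply: homo_leq => [//|? ? ?|n]; first exact: le_trans.
exact: sqrt_bound_incr.
Qed.

Lemma sqrt_iter_lin n : linear (Y n).
Proof.
have [Klin _] := Kb.
elim: n => [|n ih] c x y /=; first by rewrite scaler0 addr0.
by rewrite Klin !ih addrACA -scalerDr [LHS]scalerDr !scalerA [c * _]mulrC.
Qed.

Lemma sqrt_iter_le n x : hnorm (Y n x) <= q n * hnorm x.
Proof.
elim: n x => [|n ih] x /=; first by rewrite hnorm0 mul0r.
rewrite hnorm_scale gtr0_norm ?invr_gt0// -mulrA ler_wpM2l ?invr_ge0//.
rewrite mulrDl mul1r (le_trans (hnorm_add_le _ _))// lerD//.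
rewrite (le_trans (ih _))// expr2 -mulrA ler_wpM2l//.
by have /andP[] := sqrt_bound_itv n.
Qed.

Lemma sqrt_iterB n x y : Y n (x - y) = Y n x - Y n y.
Proof.
have h := sqrt_iter_lin n (-1) y x.
by rewrite !scaleN1r ![- _ + _]addrC in h.
Qed.

(** [2 (Y_{n+2} - Y_{n+1})] is the sum of [Y_{n+1} (Y_{n+1} - Y_n)] and
    [(Y_{n+1} - Y_n) Y_n], the factorization of a difference of squares of
    noncommuting operators, and the scalar majorant satisfies the same one. *)
Lemma sqrt_iter_step n x : hnorm (Y n.+1 x - Y n x) <= (q n.+1 - q n) * hnorm x.
Proof.
elim: n x => [|n ih] x.
  by rewrite /= !subr0; exact: (sqrt_iter_le 1).
have -> : Y n.+2 x - Y n.+1 x =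
    2^-1%:C *: (Y n.+1 (Y n.+1 x - Y n x) + (Y n.+1 (Y n x) - Y n (Y n x))).
  rewrite sqrt_iterB addrA subrK.
  rewrite [Y n.+2 x]/(2^-1%:C *: (K x + Y n.+1 (Y n.+1 x))).
  rewrite [in X in _ - X = _]/(Y n.+1 x) -scalerBr opprD addrACA subrr add0r //.
rewrite hnorm_scale gtr0_norm ?invr_gt0//.
have -> : q n.+2 - q n.+1 =
    2^-1 * (q n.+1 * (q n.+1 - q n) + (q n.+1 - q n) * q n).
  transitivity (2^-1 * (1 + q n.+1 ^+ 2) - 2^-1 * (1 + q n ^+ 2)) => //.
  by move: (q n.+1) (q n) => r s; ring.
rewrite -mulrA ler_wpM2l ?invr_ge0// mulrDl.
rewrite (le_trans (hnorm_add_le _ _))// lerD//.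
  rewrite (le_trans (sqrt_iter_le _ _))// -mulrA ler_wpM2l//.
  by have /andP[] := sqrt_bound_itv n.+1.
rewrite (le_trans (ih _))// -mulrA ler_wpM2l ?subr_ge0 ?sqrt_bound_incr//.
exact: sqrt_iter_le.
Qed.

Lemma sqrt_iter_dist m n x : (n <= m)%N ->
  hnorm (Y m x - Y n x) <= (q m - q n) * hnorm x.
Proof.
move=> /subnK <-; elim: (m - n)%N => [|k ih].
  by rewrite !subrr hnorm0 mul0r.
apply: le_trans (hnorm_triangle (Y (k + n) x) _ _) _.
apply: le_trans (lerD (sqrt_iter_step _ _) ih) _.
by rewrite -mulrDl addSn addrA subrK.
Qed.

Lemma sqrt_iter_cvg x : exists l, hcvg (fun n => Y n x) l.
Proof.
have qc : cvgn q.
  apply: nondecreasing_is_cvgn; first exact: sqrt_bound_mono.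
  by exists 1 => _ [n _ <-]; have /andP[] := sqrt_bound_itv n.
apply: (@hcvg_cauchy _ _ _ (fun n => (limn q - q n) * hnorm x)).
  move=> m n nm; apply: le_trans (sqrt_iter_dist _ nm) _.
  rewrite ler_wpM2r ?hnorm_ge0// lerB//.
  by apply: nondecreasing_cvgn_le => //; exact: sqrt_bound_mono.
apply: cvg0_mulr; rewrite -[X in _ --> X](subrr (limn q)).
by apply: cvgB => //; exact: cvg_cst.
Qed.

(** The commutation clause concerns real-linear operators because the iteration
    only uses [K] and the real scalar [1 / 2]. *)
Lemma sqrt_limit : exists L : H -> H,
  [/\ bounded_op L /\ self_adjoint L, forall x, hnorm (L x) <= hnorm x,
      forall x, L x = 2^-1%:C *: (K x + L (L x))
    & forall A, real_bounded A -> (forall x, A (K x) = K (A x)) ->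
        forall x, A (L x) = L (A x)].
Proof.
have /choice[L LP] := sqrt_iter_cvg.
have L1 x : hnorm (L x) <= hnorm x.
  apply: hcvg_norm_le (LP x) => n; apply: le_trans (sqrt_iter_le _ _) _.
  by rewrite ler_piMl ?hnorm_ge0//; have /andP[] := sqrt_bound_itv n.
have Llin : linear L.
  move=> c x y; apply: hcvg_unique (LP _) _.
  under [X in hcvg X _]eq_fun do rewrite sqrt_iter_lin.
  exact: hcvgD (hcvgZ _ (LP x)) (LP y).
have Lb : bounded_op L by split=> //; exists 1 => x; rewrite mul1r.
have Ysa n : self_adjoint (Y n).
  elim: n => [|n ih] x y /=; first by rewrite hdot0l hdot0r.
  by rewrite hdotZl hdotZr hdotDl hdotDr !ih Ksa conjcE /= oppr0.
exists L; split=> //.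
- split=> // x y; have h z w : ip (L z) w = ip z (L w).
    have h1 := hcvg_ip w (LP z); have h2 := hcvg_ip z (LP w).
    have e : (fun n => ip (Y n w) z) = (fun n => ip (Y n z) w).
      by apply/funext => n; rewrite ipC [RHS]self_adjoint_ip.
    by rewrite [RHS]ipC; rewrite e in h2; exact: cvg_unique h1 h2.
  apply: ip_hdot_eq => //; rewrite h; congr ip.
  exact: linear_scale.
- move=> x; apply: hcvg_unique (_ : hcvg (fun n => Y n.+1 x) _) _.
    by rewrite /hcvg (cvg_shiftS (fun n => hnorm (Y n x - L x))); exact: LP.
  rewrite /=; apply: hcvgZ; apply: hcvgD; first exact: hcvg_cst.
  pose r n := hnorm (Y n x - L x) + hnorm (Y n (L x) - L (L x)).
  apply: (@hcvg_le _ _ _ _ r).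
    move=> n; apply: le_trans (hnorm_triangle (Y n (L x)) _ _) _.
    rewrite lerD2r -sqrt_iterB (le_trans (sqrt_iter_le _ _))//.
    by rewrite ler_piMl ?hnorm_ge0//; have /andP[] := sqrt_bound_itv n.
  by rewrite -[X in _ --> X](addr0 0); apply: cvgD; exact: LP.
move=> A Ab AK x; have [AD AZ _] := Ab.
have AY n z : A (Y n z) = Y n (A z).
  elim: n z => [|n ih] z /=; first exact: real_bounded0.
  by rewrite AZ AD AK !ih.
apply: hcvg_unique (LP _); have := hcvg_app Ab (LP x).
by rewrite /comp; under [X in hcvg X _ -> _]eq_fun do rewrite AY.
Qed.
End SquareRootIteration.

Section SquareRoot.
Variables (R : realType) (H : hilbertType R).
Implicit Types (x y z : H) (T S G A : H -> H).

(** If [M] bounds [G], then [K = 1 - G / M] is a contraction, because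
    [|G x| ^ 2 <= M <G x, x>]; the root is [sqrt M] times [1 - L], where [L] is
    the limit of the iteration for [K]. *)
Theorem sqrt_exists G : positive_op G -> exists S,
  [/\ positive_op S, forall x, S (S x) = G x
    & forall A, real_bounded A -> (forall x, A (G x) = G (A x)) ->
        forall x, A (S x) = S (A x)].
Proof.
move=> Gp; have /positive_opP[Gb Gsa G0] := Gp.
have [Glin _] := Gb.
have [M0 M0_ge0 GM0] := real_bounded_ge0 (bounded_op_real Gb).
pose M := M0 + 1.
have M_gt0 : 0 < M by rewrite ltr_wpDl.
have GM x : hnorm (G x) <= M * hnorm x.
  by rewrite (le_trans (GM0 x))// ler_wpM2r ?hnorm_ge0// lerDl.
pose K x := x - M^-1%:C *: G x.
have Kb : bounded_op K.
  split.
    move=> c x y; rewrite /K Glin scalerDr !scalerA mulrC -scalerA scalerBr.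
    rewrite opprD; exact: addrACA.
  exists 2 => x; apply: le_trans (hnorm_add_le _ _) _.
  rewrite hnorm_opp hnorm_scale gtr0_norm ?invr_gt0//.
  by rewrite mulr2n mulrDl mul1r lerD2l ler_pdivrMl.
have Ksa : self_adjoint K.
  by move=> x y; rewrite /K hdotBl hdotBr hdotZl hdotZr Gsa conjcE/= oppr0.
have K1 x : hnorm (K x) <= hnorm x.
  apply: hnorm_le; first exact: hnorm_ge0.
  have Gx : ip (G x) (G x) <= M * ip (G x) x.
    apply: positive_sqr_le => //; apply: le_trans (ip_le _ _) _.
    by rewrite -sqr_hnorm expr2 mulrA ler_wpM2r ?hnorm_ge0.
  rewrite sqr_hnorm /K !ipE (ipC x (G x)).
  have Mi : 0 < M^-1 by rewrite invr_gt0.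
  have h : M^-1 * (M^-1 * ip (G x) (G x)) <= M^-1 * ip (G x) x.
    by rewrite ler_pM2l// ler_pdivrMl.
  have h0 : 0 <= M^-1 * ip (G x) x by rewrite mulr_ge0// ltW.
  lra.
have [L [[Lb Lsa] L1 LE LA]] := sqrt_limit Kb Ksa K1.
have rL := bounded_op_real Lb; have [Llin _] := Lb.
pose c := (Num.sqrt M)%:C : R[i].
have cc : c * c = M%:C.
  by rewrite /c -rmorphM -expr2 sqr_sqrtr// ltW.
exists (fun x => c *: (x - L x)); split.
- apply/positive_opP; split.
  + split.
      move=> d x y; rewrite Llin opprD addrACA -scalerBr scalerDr !scalerA.
      by rewrite [c * d]mulrC.
    exists (Num.sqrt M * 2) => x; rewrite hnorm_scale ger0_norm ?sqrtr_ge0//.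
    rewrite -mulrA ler_wpM2l ?sqrtr_ge0// (le_trans (hnorm_add_le _ _))//.
    by rewrite hnorm_opp mulr2n mulrDl mul1r lerD2l.
  + by move=> x y; rewrite hdotZl hdotZr hdotBl hdotBr Lsa conjcE/= oppr0.
  + move=> x; rewrite ipZl mulr_ge0 ?sqrtr_ge0// ipBl subr_ge0.
    rewrite (le_trans (ip_le _ _))// -sqr_hnorm expr2 ler_wpM2r ?hnorm_ge0//.
- move=> x; rewrite (linear_scale _ _ Llin) -scalerBr scalerA cc.
  rewrite real_boundedB//.
  have -> : x - L x - (L x - L (L x)) = M^-1%:C *: G x.
    have h : L x + L x = K x + L (L x).
      by rewrite {1 2}LE -scalerDr half_scale.
    by rewrite opprB addrACA -opprD h /K [x - _ + _]addrAC subKr.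
  by rewrite scalerA -rmorphM/= divff ?gt_eqF// scale1r.
move=> A Ab AG x; have [AD AZ _] := Ab.
have AK y : A (K y) = K (A y) by rewrite /K real_boundedB// AZ AG.
by rewrite AZ real_boundedB// LA.
Qed.

(** The difference [y = T x - S x] of two positive square roots satisfies
    [<T y, y> + <S y, y> = <(T + S) (T - S) x, y> = 0]. *)
Lemma sqrt_unique T S : positive_op T -> positive_op S ->
  (forall x, T (T x) = S (S x)) -> (forall x, T (S x) = S (T x)) ->
  forall x, T x = S x.
Proof.
move=> Tp Sp TS2 TS x.
have /positive_opP[Tb Tsa T0] := Tp; have /positive_opP[Sb Ssa S0] := Sp.
have [rT rS] := (bounded_op_real Tb, bounded_op_real Sb).
have null U y : positive_op U -> ip (U y) y = 0 -> U y = 0.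
  move=> Up Uy; apply: ip_eq0; apply/eqP; rewrite -sqrf_eq0.
  rewrite eq_le sqr_ge0 andbT (le_trans (positive_cauchy_schwarz _ _ Up))//.
  by rewrite Uy mul0r.
pose y := T x - S x.
have sum0 : ip (T y) y + ip (S y) y = 0.
  rewrite -ipDl /y (real_boundedB _ _ rT) (real_boundedB _ _ rS) TS2 TS.
  by rewrite addrA subrK subrr ip0l.
have Ty : T y = 0.
  by apply: null => //; have := T0 y; have := S0 y; lra.
have Sy : S y = 0.
  by apply: null => //; have := T0 y; have := S0 y; lra.
apply/eqP; rewrite -subr_eq0; apply/eqP/ip_eq0; rewrite -/y {1}/y ipBl.
by rewrite !self_adjoint_ip// Ty Sy ip0r subr0.
Qed.

(** The root of [T ^ 2] produced by the iteration commutes with all that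
    commutes with [T ^ 2], in particular with [T]; by uniqueness it is [T]. *)
Theorem sqrt_commute T A : positive_op T -> real_bounded A ->
  (forall x, A (T (T x)) = T (T (A x))) -> forall x, A (T x) = T (A x).
Proof.
move=> Tp Ab AT; have /positive_opP[Tb Tsa T0] := Tp.
have [Tlin _] := Tb; have [M M0 TM] := real_bounded_ge0 (bounded_op_real Tb).
have Gp : positive_op (fun x => T (T x)).
  apply/positive_opP; split.
  - split; first by move=> c x y; rewrite !Tlin.
    by exists (M * M) => x; rewrite (le_trans (TM _))// -mulrA ler_wpM2l.
  - by move=> x y; rewrite !Tsa.
  - by move=> x; rewrite self_adjoint_ip// ip_ge0.
have [S [Sp S2 SA]] := sqrt_exists Gp.
have TS : forall x, T x = S x.
  apply: sqrt_unique => // x; apply: SA => //; exact: bounded_op_real.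
by move=> x; rewrite !TS; apply: SA.
Qed.

End SquareRoot.

(** * Projection-valued measures *)

Section SymmetricOperators.
Variables (R : realType) (H : hilbertType R).
Implicit Types (x y z : H) (P S T : H -> H).

Lemma sym_op_inj S T :
  (forall x y, S (x + y) = S x + S y) -> (forall x y, T (x + y) = T x + T y) ->
  (forall x y, ip (S x) y = ip x (S y)) ->
  (forall x y, ip (T x) y = ip x (T y)) ->
  (forall x, ip (S x) x = ip (T x) x) -> forall x, S x = T x.
Proof.
move=> SD TD Ss Ts ST x; apply: ip_inj => y.
have := ST (x + y); rewrite SD TD !ipE !ST (Ss y x) (Ts y x) !(ipC y); lra.
Qed.

Lemma proj_sym P x y : orthogonal_projection P -> ip (P x) y = ip x (P y).
Proof. by case=> _ Psa _; exact: self_adjoint_ip. Qed.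

Lemma proj_real P : orthogonal_projection P -> real_bounded P.
Proof. by case=> /bounded_op_real. Qed.

(** A symmetric operator that preserves the range of [P] also preserves its
    orthogonal complement.  Symmetry is required for the real inner product
    only, so that [T] may be conjugate-linear. *)
Lemma invariant_commute P T : orthogonal_projection P ->
  (forall x y, ip (T x) y = ip x (T y)) ->
  (forall x, P (T (P x)) = T (P x)) -> forall x, P (T x) = T (P x).
Proof.
move=> [_ Psa _] Tsa PTP x; apply: ip_inj => y.
rewrite self_adjoint_ip// Tsa -PTP -self_adjoint_ip// -Tsa.
by rewrite -self_adjoint_ip// PTP.
Qed.

End SymmetricOperators.

Section ProjectionValuedMeasures.
Variables (R : realType) (H : hilbertType R) (E : set R -> H -> H).
Hypothesis hE : projection_valued_measure E.
Implicit Types (x y z : H) (A B D : set R) (T S : H -> H).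

Lemma pvm_proj D : measurable D -> orthogonal_projection (E D).
Proof. by case: hE => + _ _; exact. Qed.

Local Notation nE D x := (ip (E D x) (E D x)).

(** All information on [E] enters through the scalar measures, whose values
    are the squared norms [nE D x] of [E D x]; the lemmas below turn additivity
    of these numbers into relations between projections. *)
Lemma pvm_scalar x (mu : {measure set R -> \bar R}) D : scalar_measure E x mu ->
  measurable D -> mu D = (nE D x)%:E.
Proof. by move=> mux mD; rewrite mux// -proj_ip//; exact: pvm_proj. Qed.

Lemma pvm_measure x :
  exists mu : {measure set R -> \bar R}, scalar_measure E x mu.
Proof. by case: hE. Qed.

Lemma pvmU A B x : measurable A -> measurable B -> A `&` B = set0 ->
  nE (A `|` B) x = nE A x + nE B x.
Proof.
move=> mA mB AB; have [mu mux] := pvm_measure x.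
apply: EFin_inj; rewrite EFinD -!(pvm_scalar mux)//; last exact: measurableU.
exact: measureU.
Qed.

Lemma pvmT x : E setT x = x.
Proof. by case: hE. Qed.

Lemma pvm_split D x : measurable D -> nE D x + nE (~` D) x = ip x x.
Proof.
move=> mD; rewrite -pvmU ?setICr ?setUCr ?pvmT//; exact: measurableC.
Qed.

(** By additivity [E(D)] and [E(~D)] share out the squared norm of every
    vector, so each annihilates the range of the other. *)
Lemma pvm_compl D x : measurable D -> E (~` D) x = x - E D x.
Proof.
move=> mD; have mC := measurableC mD.
have [oD oC] := (pvm_proj mD, pvm_proj mC).
have [_ _ DD] := oD.
have C0 y : E D y = y -> E (~` D) y = 0.
  by move=> Dy; apply: ip_eq0; have := pvm_split y mD; rewrite Dy; lra.
have C1 y : E D y = 0 -> E (~` D) y = y.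
  move=> Dy; apply/esym/eqP; rewrite -subr_eq0; apply/eqP/ip_eq0.
  by rewrite proj_pythagoras//; have := pvm_split y mD; rewrite Dy ip0l; lra.
have {1}-> : x = (x - E D x) + E D x by rewrite subrK.
have [[Clin _] _ _] := oC.
have := Clin 1 (x - E D x) (E D x); rewrite !scale1r => ->.
by rewrite (C0 (E D x))// addr0 C1// op_projB// DD subrr.
Qed.

Lemma pvm_le A B x : measurable A -> measurable B -> A `<=` B ->
  nE A x <= nE B x.
Proof.
move=> mA mB AB; have -> : B = A `|` (B `\` A) by rewrite setDUK.
rewrite pvmU//; [by rewrite lerDl ip_ge0|exact: measurableD|exact: setDIK].
Qed.

Lemma pvm_sub A B x : measurable A -> measurable B -> A `<=` B ->
  E B (E A x) = E A x.
Proof.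
move=> mA mB AB; have [oA oB] := (pvm_proj mA, pvm_proj mB).
have [_ _ AA] := oA.
apply/esym/eqP; rewrite -subr_eq0; apply/eqP/ip_eq0; apply/eqP.
rewrite eq_le ip_ge0 andbT proj_pythagoras// subr_le0.
by have := pvm_le (E A x) mA mB AB; rewrite AA.
Qed.

(** Symmetric operators are determined by their quadratic forms, and those are
    additive. *)
Lemma pvmD A B x : measurable A -> measurable B -> A `<=` B ->
  E (B `\` A) x = E B x - E A x.
Proof.
move=> mA mB AB; have [oA oB] := (pvm_proj mA, pvm_proj mB).
have mD : measurable (B `\` A) by exact: measurableD.
have oD := pvm_proj mD.
apply: (sym_op_inj (S := E (B `\` A)) (T := fun y => E B y - E A y)).
- by have [] := proj_real oD.
- have [[BD _ _] [AD _ _]] := (proj_real oB, proj_real oA).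
  by move=> y z; rewrite BD AD opprD addrACA.
- by move=> y z; exact: proj_sym.
- by move=> y z; rewrite ipBl ipBr !proj_sym.
move=> y; rewrite ipBl !proj_ip//.
have -> : nE B y = nE A y + nE (B `\` A) y by rewrite -pvmU ?setDUK ?setDIK.
by rewrite addrAC subrr add0r.
Qed.

(** On the range of [E(A)] the projection [E(B)] coincides with the projection
    of the intersection of [A] and [B], whose range is contained in that of
    [E(A)]. *)
Lemma pvm_comm A B x : measurable A -> measurable B ->
  E A (E B x) = E B (E A x).
Proof.
move=> mA mB; have [oA oB] := (pvm_proj mA, pvm_proj mB).
have [_ Bsa _] := oB; have [_ _ AA] := oA.
apply: (invariant_commute oA) => [u v|{}x]; first exact: self_adjoint_ip.
have mBA : measurable (B `&` A) by exact: measurableI.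
have mC : measurable (~` A) by exact: measurableC.
have mD : measurable (B `\` (B `&` A)) by exact: measurableD.
have sBA : B `&` A `<=` B by exact: subIsetl.
have D0 : E (B `\` (B `&` A)) (E A x) = 0.
  apply: ip_eq0; apply/eqP; rewrite eq_le ip_ge0 andbT.
  have DA : B `\` (B `&` A) `<=` ~` A by move=> t [Bt /= nBA] At; exact: nBA.
  by rewrite (le_trans (pvm_le _ mD mC DA))// pvm_compl// AA subrr ip0l.
have <- : E (B `&` A) (E A x) = E B (E A x).
  by apply/esym/eqP; rewrite -subr_eq0 -pvmD// D0.
exact: pvm_sub.
Qed.

(** The squared distance to the limit is a difference of values of a scalar
    measure, so strong convergence follows from continuity from below. *)
Lemma pvm_cvg (F : nat -> set R) x : (forall n, measurable (F n)) ->
  {homo F : n m / (n <= m)%N >-> n `<=` m} ->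
  hcvg (fun n => E (F n) x) (E (\bigcup_n F n) x).
Proof.
move=> mF ndF.
have mU : measurable (\bigcup_n F n) by exact: bigcupT_measurable.
have FU n : F n `<=` \bigcup_n F n by exact: bigcup_sup.
have [mu mux] := pvm_measure x.
have : (fun n => nE (F n) x) @ \oo --> nE (\bigcup_n F n) x.
  have ndF' : {homo F : n m / (n <= m)%N >-> (n <= m)%O}.
    by move=> n m nm; apply/subsetPset; exact: ndF.
  have := nondecreasing_cvg_mu (mu := mu) mF mU ndF'.
  rewrite (pvm_scalar mux mU) => /fine_cvgP[_].
  rewrite (_ : fine \o (mu \o F) = (fun n => nE (F n) x))//.
  by apply/funext => n /=; rewrite (pvm_scalar mux).
move=> h; pose r n := Num.sqrt (nE (\bigcup_n F n) x - nE (F n) x).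
apply: (@hcvg_le _ _ _ _ r).
  move=> n; apply: hnorm_le; first exact: sqrtr_ge0.
  rewrite sqr_sqrtr; last by rewrite subr_ge0 pvm_le.
  have e : nE (\bigcup_n F n) x = nE (F n) x + nE (\bigcup_n F n `\` F n) x.
    by rewrite -pvmU ?setDUK ?setDIK//; exact: measurableD.
  rewrite -[_ - E _ x]opprB -pvmD// ipNl ipNr opprK e addrAC subrr add0r//.
apply: cvg0_sqrt; rewrite -[X in _ --> X](subrr (nE (\bigcup_n F n) x)).
by apply: cvgB => //; exact: cvg_cst.
Qed.

(** [T] commutes with the unitary [U = 2 E(D) - 1]: as [U] commutes with all
    [E(B)], the vectors [x] and [U x] have the same scalar measure, hence
    [<T U x, U x> = <T x, x>]. *)
Lemma spectral_commute T D : bounded_op T -> self_adjoint T ->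
  spectral_integral E id T -> measurable D ->
  forall x, E D (T x) = T (E D x).
Proof.
move=> Tb Tsa ET mD; have oD := pvm_proj mD; have [_ Dsa DD] := oD.
have rD := proj_real oD.
have rT := bounded_op_real Tb.
pose U x := E D x - (x - E D x).
have UD x y : U (x + y) = U x + U y.
  by rewrite /U; have [-> _ _] := rD; apply: ip_inj => z; rewrite !ipE; lra.
have Usa x y : ip (U x) y = ip x (U y).
  by rewrite /U !ipE !self_adjoint_ip.
have UU x : U (U x) = x.
  rewrite /U !(real_boundedB _ _ rD) DD.
  apply: ip_inj => z; rewrite !ipE.
  move: (ip x z) (ip (E D x) z) => r s.
  lra.
have UT x : ip (T (U x)) (U x) = ip (T x) x.
  have UE B : measurable B -> nE B (U x) = nE B x.
    move=> mB; have rB := proj_real (pvm_proj mB).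
    have -> : E B (U x) = U (E B x).
      by rewrite /U !(real_boundedB _ _ rB) pvm_comm.
    by rewrite Usa UU.
  have [mu mux [_ muT]] := ET x; have [nu nux [_ nuT]] := ET (U x).
  rewrite /ip muT nuT; congr Re; congr (_%:C); rewrite /Rintegral; congr fine.
  apply: eq_measure_integral => B mB _.
  by rewrite (pvm_scalar mux)// (pvm_scalar nux)// UE.
have UTU x : U (T (U x)) = T x.
  apply: (sym_op_inj (S := fun y => U (T (U y))) (T := T)) =>
    [y z|y z|y z|y z|y].
  - by have [TD _ _] := rT; rewrite UD TD UD.
  - by have [TD _ _] := rT; rewrite TD.
  - by rewrite Usa self_adjoint_ip// -Usa.
  - exact: self_adjoint_ip.
  - by rewrite Usa UT.
move=> x; have := congr1 U (UTU x); rewrite UU /U !(real_boundedB _ _ rT) => TU.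
apply: ip_inj => z; have := congr1 (fun y => ip y z) TU; rewrite !ipE.
move: (ip (T x) z) (ip (E D (T x)) z) (ip (T (E D x)) z) => p q r; lra.
Qed.

End ProjectionValuedMeasures.

(** * Spectral subspaces and growth of powers *)

Section SpectralSubspaces.
Variables (R : realType) (H : hilbertType R) (E : set R -> H -> H) (T : H -> H).
Hypothesis hE : projection_valued_measure E.
Hypothesis Tp : positive_op T.
Hypothesis ET : spectral_integral E id T.
Implicit Types (x y z : H) (D : set R) (c s : R).

Let Tb : bounded_op T. Proof. by case: Tp. Qed.
Let Tsa : self_adjoint T. Proof. by case: Tp. Qed.

(** The scalar measure of a vector in the range of [E(D)] does not charge the
    complement of [D]. *)
Lemma range_integral D y : measurable D -> E D y = y ->
  exists2 mu : {measure set R -> \bar R}, mu D = (ip y y)%:E &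
    mu.-integrable D (EFin \o id) /\ ip (T y) y = \int[mu]_(t in D) t.
Proof.
move=> mD Dy; have [mu muy [iT TE]] := ET y.
have mC := measurableC mD.
have C0 : mu (~` D) = 0%E.
  by rewrite (pvm_scalar hE muy)// pvm_compl// Dy subrr ip0l.
exists mu; first by rewrite (pvm_scalar hE muy)// Dy.
split; first by apply: integrableS iT.
rewrite /ip TE /Rintegral /=; congr fine.
by rewrite (negligible_integral mC)// setTD setCK.
Qed.

Lemma range_integrable_cst (mu : {measure set R -> \bar R}) D r (c : R) :
  measurable D -> mu D = r%:E -> mu.-integrable D (EFin \o cst c).
Proof.
move=> mD muD; apply/integrableP; split.
  exact: (@measurable_cst _ _ _ _ _ c%:E).
by under eq_integral do rewrite /=; rewrite integral_cst//= muD -EFinM ltry.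
Qed.

Lemma range_upper D y c : measurable D -> E D y = y ->
  (forall t, D t -> t <= c) -> ip (T y) y <= c * ip y y.
Proof.
move=> mD Dy Dc; have [mu muD [iT ->]] := range_integral mD Dy.
have -> : c * ip y y = \int[mu]_(t in D) c by rewrite Rintegral_cst// muD.
by apply: le_Rintegral => //; exact: range_integrable_cst muD.
Qed.

Lemma range_lower D y c : measurable D -> E D y = y ->
  (forall t, D t -> c <= t) -> c * ip y y <= ip (T y) y.
Proof.
move=> mD Dy Dc; have [mu muD [iT ->]] := range_integral mD Dy.
have -> : c * ip y y = \int[mu]_(t in D) c by rewrite Rintegral_cst// muD.
by apply: le_Rintegral => //; exact: range_integrable_cst muD.
Qed.

Lemma range_iter D y n : measurable D -> E D y = y ->
  E D (iter n T y) = iter n T y.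
Proof.
move=> mD Dy; elim: n => [//|n ih] /=.
by rewrite (spectral_commute hE Tb Tsa ET)// ih.
Qed.

Lemma iter_lower s y n : 0 < s -> E `[s, +oo[ y = y ->
  s ^+ n * hnorm y <= hnorm (iter n T y).
Proof.
move=> s0 Dy; have mD : measurable (`[s, +oo[ : set R) by exact: measurable_itv.
elim: n => [|n ih]; first by rewrite mul1r.
set w := iter n T y in ih *; have Dw : E `[s, +oo[ w = w by exact: range_iter.
rewrite exprS -mulrA /= -/w; apply: le_trans (ler_wpM2l (ltW s0) ih) _.
have [->|w0] := eqVneq (hnorm w) 0; first by rewrite mulr0 hnorm_ge0.
have hw : 0 < hnorm w by rewrite lt_neqAle eq_sym w0 hnorm_ge0.
rewrite -(ler_pM2r hw) -mulrA -expr2 sqr_hnorm (le_trans _ (ip_le _ _))//.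
by apply: (range_lower mD Dw) => t /=; rewrite in_itv/= andbT.
Qed.

Lemma iter_upper c y n : 0 <= c -> E `]-oo, c] y = y ->
  hnorm (iter n T y) <= c ^+ n * hnorm y.
Proof.
move=> c0 Dy; have mD : measurable (`]-oo, c] : set R) by exact: measurable_itv.
elim: n => [|n ih]; first by rewrite mul1r.
rewrite exprS -mulrA /=; apply: le_trans (ler_wpM2l c0 ih).
set w := iter n T y; have Dw k : E `]-oo, c] (iter k T w) = iter k T w.
  by apply: range_iter => //; exact: range_iter.
have Dc (t : R) : `]-oo, c]%classic t -> t <= c by rewrite /= in_itv.
apply: hnorm_le; first by rewrite mulr_ge0 ?hnorm_ge0.
rewrite exprMn sqr_hnorm expr2 -mulrA.
apply: le_trans (positive_sqr_le Tp (range_upper mD (Dw 1) Dc)) _.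
by rewrite ler_wpM2l// (range_upper mD (Dw 0)).
Qed.

(** For [s > c], the part of [y] in the range of [E([s, +oo[)] grows at least
    like [s ^ n] under the powers of [T], faster than the bound allows; hence
    it vanishes.  Together with [iter_upper] this describes the range of
    [E(]-oo, c])] by a growth condition. *)
Lemma growth_range c y (M : R) : 0 <= c ->
  (forall n, hnorm (iter n T y) <= M * c ^+ n) -> E `]-oo, c] y = y.
Proof.
move=> c0 Ty.
have mD (b : bool) (s : R) : measurable [set` Interval (BSide b s) +oo%O].
  exact: measurable_itv.
have zero s : c < s -> E `[s, +oo[ y = 0.
  move=> cs; have s0 : 0 < s := le_lt_trans c0 cs.
  have o := pvm_proj hE (mD true s); have [_ _ PP] := o.
  apply: hnorm_eq0; apply/eqP; rewrite eq_le hnorm_ge0 andbT.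
  have le n : hnorm (E `[s, +oo[ y) <= M * (c / s) ^+ n.
    rewrite expr_div_n mulrA ler_pdivlMr ?exprn_gt0// mulrC.
    apply: le_trans (iter_lower n s0 (PP y)) _.
    have -> : iter n T (E `[s, +oo[ y) = E `[s, +oo[ (iter n T y).
      elim: n => [//|n /= ->]; by rewrite -(spectral_commute hE Tb Tsa ET).
    exact: le_trans (proj_le _ o) (Ty n).
  have cv : (fun n => M * (c / s) ^+ n) @ \oo --> (0 : R).
    rewrite -[X in _ --> X](mulr0 M); apply: cvgM; first exact: cvg_cst.
    apply: cvg_expr; rewrite ger0_norm ?divr_ge0 ?(ltW s0)//.
    by rewrite ltr_pdivrMr// mul1r.
  rewrite -(cvg_lim _ cv)//; apply: limr_ge; first exact: cvgP cv.
  by near=> n; exact: le.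
have := pvm_compl hE y (mD false c); rewrite setCitvr => ->.
rewrite itvoyEbigcup.
have F0 : hcvg (fun k => E `[c + k.+1%:R^-1, +oo[ y) 0.
  have -> : (fun k => E `[c + k.+1%:R^-1, +oo[ y) = fun=> 0.
    by apply/funext => k; apply: zero; rewrite ltrDl invr_gt0 ltr0n.
  exact: hcvg_cst.
have F1 := pvm_cvg hE y (F := fun k => `[c + k.+1%:R^-1, +oo[%classic)
  (fun k => mD true _).
rewrite -(hcvg_unique F0 (F1 _)) ?subr0// => n m nm t /=.
rewrite !in_itv/= !andbT; apply: le_trans.
by rewrite lerD2l lef_pV2 ?posrE ?ltr0n// ler_nat.
Unshelve. all: by end_near. Qed.

Variable A : H -> H.
Hypothesis Ab : real_bounded A.
Hypothesis Asym : forall x y, ip (A x) y = ip x (A y).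
Hypothesis AT : forall x, A (T x) = T (A x).

(** The growth condition is preserved by any bounded operator that commutes
    with [T].  For [c < 0] the range is trivial since [T] is positive. *)
Lemma ray_commute c x : E `]-oo, c] (A x) = A (E `]-oo, c] x).
Proof.
have mD : measurable (`]-oo, c] : set R) by exact: measurable_itv.
have o := pvm_proj hE mD; have [_ _ PP] := o.
apply: (invariant_commute o Asym) => {}x; set y := E _ x.
have [c0|c0] := leP 0 c.
  have [M M0 AM] := real_bounded_ge0 Ab.
  apply: (@growth_range _ _ (M * hnorm y)) => // n.
  have -> : iter n T (A y) = A (iter n T y).
    by elim: n => [//|n /= ->]; rewrite AT.
  apply: le_trans (AM _) _.
  by rewrite -mulrA ler_wpM2l// mulrC iter_upper// PP.
have -> : y = 0.
  apply: ip_eq0; apply/eqP; rewrite eq_le ip_ge0 andbT.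
  have /positive_opP[_ _ T0] := Tp.
  have : ip (T y) y <= c * ip y y.
    by apply: (range_upper mD) => [|t /=]; [exact: PP|rewrite in_itv].
  by move/(le_trans (T0 y)); rewrite nmulr_rge0.
by rewrite real_bounded0// op_proj0.
Qed.

(** The sets whose projection commutes with [A] form a lambda-system which
    contains the rays. *)
Theorem spectral_projection_commute D x : measurable D -> E D (A x) = A (E D x).
Proof.
pose C : set (set R) :=
  [set B | measurable B /\ forall y, E B (A y) = A (E B y)].
suff CP B : measurable B -> C B by move=> mD; have [_ ->] := CP _ mD.
have -> : (measurable : set (set R)) = <<s @RGenOInfty.G R >>.
  exact: (RGenOInfty.measurableE R).
move=> mB.
apply: (lambda_system_subset (D := setT) _ _ _ _ mB) => //.
- move=> _ _ [s ->] [t ->]; exists (Num.max s t); apply/seteqP; split=> r /=;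
    by rewrite !in_itv/= !andbT gt_max => /andP.
- split=> //.
  + by split=> // y; rewrite !pvmT.
  + move=> B1 B2 B21 [mB1 cB1] [mB2 cB2]; split; first exact: measurableD.
    by move=> y; rewrite !pvmD// cB1 cB2 (real_boundedB _ _ Ab).
  + move=> F ndF CF; have mF n := (CF n).1.
    split; first exact: bigcupT_measurable.
    move=> y; have ndF' : {homo F : n m / (n <= m)%N >-> n `<=` m}.
      by move=> n m nm; apply/subsetPset; exact: ndF.
    apply: hcvg_unique (pvm_cvg hE (A y) mF ndF') _.
    have := hcvg_app Ab (pvm_cvg hE y mF ndF').
    rewrite (_ : _ \o _ = (fun n => E (F n) (A y)))//.
    by apply/funext => n /=; rewrite (CF n).2.
- move=> _ [c ->]; split; first exact: measurable_itv.
  have mc : measurable (`]-oo, c] : set R) by exact: measurable_itv.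
  move=> y; rewrite -setCitvl !pvm_compl// ray_commute real_boundedB//.
Qed.

End SpectralSubspaces.

(** * Operators with a cyclic vector *)

Section Polarization.
Variables (R : realType) (H : hilbertType R).
Implicit Types (x y : H) (B : H -> H).

(** Polarization: multiplying one of two vectors by ['i] changes the relative
    sign of the two mixed terms, so both of them vanish. *)
Lemma quad_form0 B : linear B -> (forall x, hdot (B x) x = 0) ->
  forall x, B x = 0.
Proof.
move=> Blin B0 x.
have BD y z : B (y + z) = B y + B z by have := Blin 1 y z; rewrite !scale1r.
have anti y z : hdot (B y) z = - hdot (B z) y.
  have := B0 (y + z); rewrite BD hdotDl !hdotDr !B0 add0r addr0.
  by move/eqP; rewrite addr_eq0 => /eqP.
have sym y z : hdot (B y) z = hdot (B z) y.
  have := anti y ('i *: z); rewrite linear_scale// hdotZl hdotZr.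
  by rewrite conjCi mulNr => /oppr_inj/(mulfI (neq0Ci _)).
apply: ip_eq0; rewrite /ip.
have := anti x (B x); rewrite sym; case: (hdot _ _) => a b [] /= h _; lra.
Qed.

End Polarization.

Section CyclicCommutant.
Variables (R : realType) (H : hilbertType R).
Implicit Types (x y z w : H) (c : R[i]) (A Q T : H -> H).

(** This identity makes [A] conjugate-linear, and self-adjoint for the real
    inner product. *)
Definition conj_symmetric A : Prop := forall x y, hdot (A x) y = hdot (A y) x.

Lemma conj_symmetric_ip A x y : conj_symmetric A -> ip (A x) y = ip x (A y).
Proof. by move=> As; rewrite [RHS]ipC /ip As. Qed.

Lemma conj_symmetricZ A c x : conj_symmetric A -> A (c *: x) = conjC c *: A x.
Proof.
by move=> As; apply: ip_inj => z; rewrite /ip As hdotZr hdotZl As.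
Qed.

Lemma conj_symmetricD A x y : conj_symmetric A -> A (x + y) = A x + A y.
Proof.
move=> As; apply: ip_inj => z.
by rewrite ipDl !(conj_symmetric_ip _ _ As) ipDl.
Qed.

Lemma conj_symmetric0 A : conj_symmetric A -> A 0 = 0.
Proof.
by move=> As; rewrite -(scale0r 0) conj_symmetricZ// conjC0 !scale0r.
Qed.

Lemma self_adjoint_iter T n : self_adjoint T -> self_adjoint (iter n T).
Proof.
by move=> Tsa; elim: n => [//|n ih] x y; rewrite iterS Tsa ih -iterSr.
Qed.

Definition poly_op T n (c : 'I_n -> R[i]) x : H :=
  \sum_(m < n) c m *: iter m T x.

Section PolyOp.
Variables (T : H -> H) (n : nat) (c : 'I_n -> R[i]).

Lemma poly_op_commute (L : H -> H) x :
  linear L -> (forall x, L (T x) = T (L x)) ->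
  poly_op T c (L x) = L (poly_op T c x).
Proof.
move=> Llin LT; have LD y z : L (y + z) = L y + L z.
  by have := Llin 1 y z; rewrite !scale1r.
have L0 : L 0 = 0 by have := linear_scale 0 0 Llin; rewrite !scale0r.
rewrite /poly_op (big_morph L LD L0); apply: eq_bigr => m _.
rewrite linear_scale//; congr (_ *: _).
by elim: (m : nat) => [//|k ih] /=; rewrite ih LT.
Qed.

Lemma poly_op_adjoint x y : self_adjoint T ->
  hdot (poly_op T (conjC \o c) x) y = hdot x (poly_op T c y).
Proof.
move=> Tsa; rewrite hdotC /poly_op linear_sumr rmorph_sum linear_sumr.
apply: eq_bigr => m _; rewrite /= !hdotZr conjCK rmorphM/= -hdotC.
by rewrite self_adjoint_iter.
Qed.

Lemma conj_symmetric_poly A x :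
  conj_symmetric A -> (forall x, A (T x) = T (A x)) ->
  A (poly_op T c x) = poly_op T (conjC \o c) (A x).
Proof.
move=> As AT; have AD y z := conj_symmetricD y z As.
rewrite /poly_op (big_morph A AD (conj_symmetric0 As)); apply: eq_bigr => m _.
rewrite conj_symmetricZ//; congr (_ *: _).
by elim: (m : nat) => [//|k ih] /=; rewrite AT ih.
Qed.

End PolyOp.

(** Polynomials [q(T)] that approximate [Q] at the cyclic vector [w] approximate
    it on the whole orbit of [w].  Since [A q(T) = q'(T) A], where [q'] has the
    conjugate coefficients, and [q'(T)] is the adjoint of [q(T)], the operators
    [A Q] and [Q A] have the same matrix coefficients on that orbit.  As
    the approximation is only pointwise on the orbit, the two operators are
    compared through these coefficients. *)
Lemma cyclic_commutant T A Q w : bounded_op T -> self_adjoint T ->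
  cyclic_vector T w -> conj_symmetric A -> (forall x, A (T x) = T (A x)) ->
  bounded_op Q -> self_adjoint Q -> (forall x, Q (T x) = T (Q x)) ->
  forall x, Q (A x) = A (Q x).
Proof.
move=> Tb Tsa cyc As AT Qb Qsa QT; have wtot := total_of_cyclic cyc.
have [Qlin _] := Qb; have [Tlin _] := Tb.
have Aip y z := conj_symmetric_ip y z As.
(* [approx] is closed under [T] and under scalars, with a constant [N] that
   does not depend on the polynomial. *)
pose approx x := exists2 N : R, 0 <= N &
  forall n (c : 'I_n -> R[i]),
    hnorm (Q x - poly_op T c x) <= N * hnorm (Q w - poly_op T c w).
have approx_app (L : H -> H) x :
    bounded_op L -> (forall x, L (T x) = T (L x)) ->
    (forall x, L (Q x) = Q (L x)) -> approx x -> approx (L x).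
  move=> Lb LT LQ [N N0 xN]; have rL := bounded_op_real Lb.
  have [M M0 LM] := real_bounded_ge0 rL; have [Llin _] := Lb.
  exists (M * N) => [|n c]; first exact: mulr_ge0.
  rewrite -LQ poly_op_commute// -(real_boundedB _ _ rL).
  by rewrite (le_trans (LM _))// -mulrA ler_wpM2l.
have approxT l : approx (iter l T w).
  elim: l => [|l ih] /=; first by exists 1 => // n c; rewrite mul1r.
  by apply: approx_app.
have approxZ d x : approx x -> approx (d *: x).
  apply: (approx_app (fun y => d *: y)) => [|y|y]; first exact: bounded_scale.
    by rewrite linear_scale.
  by rewrite linear_scale.
have weak x y : approx x -> approx y -> ip (A (Q x)) y = ip (Q (A x)) y.
  move=> [N N0 xN] [K K0 yK]; apply/eqP; rewrite -subr_eq0 -normr_le0.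
  apply/ler_addgt0Pr => e e0; rewrite add0r.
  pose L := N * hnorm (A y) + K * hnorm (A x).
  have L0 : 0 <= L by rewrite addr_ge0 ?mulr_ge0 ?hnorm_ge0.
  have [n [c wc]] := cyc (Q w) (e / (L + 1)) (divr_gt0 e0 (ltr_wpDl L0 ltr01)).
  have {}wc : hnorm (Q w - poly_op T c w) <= e / (L + 1) := ltW wc.
  (* the contributions of the polynomial to the two terms cancel *)
  have -> : ip (A (Q x)) y - ip (Q (A x)) y =
      ip (Q x - poly_op T c x) (A y) - ip (A x) (Q y - poly_op T c y).
    have e1 : ip (poly_op T c x) (A y) = ip (A x) (poly_op T c y).
      by rewrite -Aip conj_symmetric_poly// /ip poly_op_adjoint.
    by rewrite ipBl ipBr e1 (Aip (Q x)) (self_adjoint_ip (A x) y Qsa); ring.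
  apply: le_trans (ler_normB _ _) _.
  apply: (@le_trans _ _ (L * (e / (L + 1)))); last first.
    by rewrite mulrCA ler_piMr ?(ltW e0)// ler_pdivrMr ?ltr_wpDl// mul1r lerDl.
  rewrite /L mulrDl lerD// (le_trans (ip_abs_le _ _))//.
    rewrite mulrAC ler_wpM2r ?hnorm_ge0// (le_trans (xN _ _))//.
    by rewrite ler_wpM2l.
  rewrite mulrC mulrAC ler_wpM2r ?hnorm_ge0// (le_trans (yK _ _))//.
  by rewrite ler_wpM2l.
have orbit l : A (Q (iter l T w)) = Q (A (iter l T w)).
  apply/eqP; rewrite -subr_eq0; apply/eqP/wtot => k; rewrite hdotC.
  rewrite (_ : hdot _ _ = 0) ?conjC0//.
  by apply/hdotxi; rewrite !ipBl !weak ?subrr//; exact: approxZ.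
move=> x; apply/eqP; rewrite -subr_eq0; apply/eqP/wtot => k; rewrite hdotC.
rewrite (_ : hdot _ _ = 0) ?conjC0//; apply/hdotxi.
rewrite !ipBl !(self_adjoint_ip _ _ Qsa) !Aip !(self_adjoint_ip _ _ Qsa).
split; first by rewrite orbit subrr.
rewrite (linear_scale _ _ Qlin) !(conj_symmetricZ _ _ As).
by rewrite (linear_scale _ _ Qlin) orbit subrr.
Qed.

End CyclicCommutant.

(** * Positive operators with a conjugate-linear square root of the square *)

Section ConjugateSymmetricRoot.
Variables (R : realType) (H : hilbertType R) (T A : H -> H) (u : H).
Hypothesis Tp : positive_op T.
Hypothesis Ab : real_bounded A.
Hypothesis As : conj_symmetric A.
Hypothesis AA : forall x, A (A x) = T (T x).
Hypothesis utot : forall z, (forall n, hdot (iter n A u) z = 0) -> z = 0.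
Implicit Types (x y z w : H) (c : R[i]) (P : H -> H).
Let Tb : bounded_op T. Proof. by case: Tp. Qed.
Let Tsa : self_adjoint T. Proof. by case: Tp. Qed.

Lemma conj_sym_commute x : A (T x) = T (A x).
Proof. by apply: (sqrt_commute Tp Ab) => y; rewrite -!AA. Qed.

(** [P A ^ n u = A ^ n P u = 0], and the orbit of [u] is total. *)
Lemma vanish_of_commute P : orthogonal_projection P ->
  (forall x, P (A x) = A (P x)) -> P u = 0 -> forall x, P x = 0.
Proof.
move=> oP PA Pu x; apply: utot => n; have [_ Psa _] := oP.
rewrite -Psa (_ : P _ = 0) ?hdot0l//.
by elim: n => [//|n ih] /=; rewrite PA ih real_bounded0.
Qed.

Lemma iter_double n x : iter n.*2 A x = iter n.*2 T x.
Proof. by elim: n => [//|n ih]; rewrite doubleS /= ih AA. Qed.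

(** [A ^ (2 n) u = T ^ (2 n) u] and [A ^ (2 n + 1) u = T ^ (2 n) (A u)]. *)
Lemma conj_sym_multiplicity : multiplicity_le T 2.
Proof.
apply: (multiplicity_le2 (u := u) (v := A u)) => // z uz vz; apply: utot => n.
rewrite -(odd_double_half n); case: (odd n).
  by rewrite add1n iterSr iter_double.
by rewrite add0n iter_double.
Qed.

(** The operator selected as the functional calculus of the indicator function
    of [D] has the quadratic form of [E(D)] for some spectral measure [E] of
    [T], and [E(D)] commutes with [A]. *)
Lemma conj_sym_maximal : maximal_type T u.
Proof.
move=> D mD; rewrite /functional_calculus.
case: xgetP => [B _|_ _ x]; last by [].
move=> [[Blin _] [E [hE ET] EB]] Bu.
have BE x : hdot (B x) x = (ip (E D x) (E D x))%:C.
  have [mu mux [_ ->]] := EB x.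
  by rewrite /Rintegral integral_indic// setIT (pvm_scalar hE mux).
have oD := pvm_proj hE mD.
have Eu : E D u = 0.
  by apply: ip_eq0; have := BE u; rewrite Bu hdot0l => -[].
have E0 x : E D x = 0.
  apply: (vanish_of_commute oD) => // y.
  apply: (spectral_projection_commute hE Tp ET Ab _ conj_sym_commute) => //.
  by move=> z1 z2; exact: conj_symmetric_ip.
by apply: quad_form0 => // x; rewrite BE E0 ip0l.
Qed.

(** The projection [Q] onto the complement of the closed span of the [T ^ n u]
    commutes with [T]; a cyclic vector of [T] makes it commute with [A]. *)
Lemma conj_sym_cyclic : simple_spectrum T -> cyclic_vector T u.
Proof.
move=> [w cyc]; have wtot := total_of_cyclic cyc.
have [P [oP Pu Pz PT]] := span_projection (fun n => iter n T u).
have {}PT x : P (T x) = T (P x) by apply: PT => // n; exact: in_span_iter.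
pose Q x := x - P x; have oQ : orthogonal_projection Q := projection_compl oP.
have rT := bounded_op_real Tb.
have QT x : Q (T x) = T (Q x) by rewrite /Q PT (real_boundedB _ _ rT).
have [Qb Qsa _] := oQ.
have QA := cyclic_commutant Tb Tsa cyc As conj_sym_commute Qb Qsa QT.
apply: cyclic_of_total => z uz.
have := vanish_of_commute oQ QA _ z; rewrite /Q (Pu 0%N) subrr Pz//.
by rewrite subr0; exact.
Qed.

End ConjugateSymmetricRoot.

(** * Jacobi operators *)

Section Ell2Coordinates.
Variable R : realType.
Implicit Types (x y z : ell2 R).

Lemma ell2D x y k : (x + y) k = x k + y k. Proof. by []. Qed.
Lemma ell2Z (c : R[i]) x k : (c *: x) k = c * x k. Proof. by []. Qed.
Lemma ell20 k : (0 : ell2 R) k = 0. Proof. by []. Qed.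

Lemma ell2_ext x y : (forall k, x k = y k) -> x = y.
Proof. by move=> xy; apply: val_inj; apply/funext. Qed.

Lemma hdot_delta x k : hdot x (delta R k) = x k.
Proof.
apply: has_csumE.
have key (g : R[i] -> R) : g 0 = 0 ->
    series (fun j => g (x j * conjC ((j == k)%:R : R[i]))) @ \oo --> g (x k).
  move=> g0; apply: cvg_near_cst; near=> n.
  have kn : (k < n)%N by near: n; exact: nbhs_infty_gt.
  rewrite /series/= (bigD1_seq k) ?iota_uniq ?mem_index_iota//= eqxx conjC1.
  by rewrite mulr1 big1 ?addr0// => j /negPf ->; rewrite conjC0 mulr0.
by split; [exact: (key (@complex.Re R))|exact: (key (@complex.Im R))].
Unshelve. all: by end_near. Qed.

Lemma ip_ell2 x : ip x x = Re (ell2_dot x x). Proof. by []. Qed.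

Lemma delta_total z : (forall n, hdot (delta R n) z = 0) -> z = 0.
Proof.
move=> zd; apply: ell2_ext => k.
by rewrite -[LHS]hdot_delta hdotC zd conjC0.
Qed.

Lemma sqabs_conj (c : R[i]) : sqabs (conjC c) = sqabs c.
Proof. by rewrite !sqabsE conjcE/= sqrrN. Qed.

Lemma square_summable_conj x : square_summable (fun k => conjC (x k)).
Proof.
have := ell2P x; rewrite /square_summable.
by under [X in _ -> cvgn (series X)]eq_fun do rewrite sqabs_conj.
Qed.

Definition ell2_conj x : ell2 R := mk_ell2 (@square_summable_conj x).

Lemma ell2_conjK x : ell2_conj (ell2_conj x) = x.
Proof. by apply: ell2_ext => k /=; rewrite conjCK. Qed.

Lemma ell2_conj_dot x y : hdot (ell2_conj x) (ell2_conj y) = conjC (hdot x y).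
Proof.
apply: has_csumE; have := has_csumC (has_csum_mul (ell2P x) (ell2P y)).
by under [X in has_csum X _ -> _]eq_fun do rewrite rmorphM/=.
Qed.

Lemma ell2_conjZ (c : R[i]) x y :
  ell2_conj (c *: x + y) = conjC c *: ell2_conj x + ell2_conj y.
Proof. by apply: ell2_ext => k; rewrite /= rmorphD rmorphM. Qed.

Lemma ell2_conj_norm x : hnorm (ell2_conj x) = hnorm x.
Proof.
apply/eqP; rewrite -(@eqrXn2 _ 2) ?hnorm_ge0// !sqr_hnorm.
by rewrite /ip ell2_conj_dot conjcE.
Qed.

End Ell2Coordinates.

Section JacobiOperator.
Variables (R : realType) (a : nat -> R) (b : nat -> R[i]).
Hypothesis ab : jacobi_bounded a b.
Implicit Types (x y z : ell2 R).

Local Notation J := (jacobi ab).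

Lemma jacobiE x j : J x j =
  (if j is i.+1 then (a i)%:C * x i else 0) + (b j * x j + (a j)%:C * x j.+1).
Proof. by rewrite /jacobi/= jacobi_seqE. Qed.

Lemma jacobi_linear : linear J.
Proof.
move=> c x y; apply: ell2_ext => j; rewrite ell2D ell2Z !jacobiE.
by case: j => [|j]; rewrite !ell2D !ell2Z; ring.
Qed.

Lemma sqabsM (p q : R[i]) : sqabs (p * q) = sqabs p * sqabs q.
Proof. by rewrite !sqabsE; case: p q => [? ?] [? ?] /=; ring. Qed.

Lemma sqabs_add3 (p q r : R[i]) :
  sqabs (p + (q + r)) <= 3 * (sqabs p + sqabs q + sqabs r).
Proof.
rewrite !sqabsE; case: p q r => [p1 p2] [q1 q2] [r1 r2] /=; rewrite -subr_ge0.
set d := (X in 0 <= X).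
have -> : d = (p1 - q1) ^+ 2 + (q1 - r1) ^+ 2 + (p1 - r1) ^+ 2 +
  ((p2 - q2) ^+ 2 + (q2 - r2) ^+ 2 + (p2 - r2) ^+ 2) by rewrite /d; ring.
by rewrite !addr_ge0 ?sqr_ge0.
Qed.

Lemma sqabs_le (p : R[i]) (M : R) : `|p| <= M%:C -> sqabs p <= M ^+ 2.
Proof.
move=> pM; have M0 : 0 <= M by have := le_trans (normr_ge0 _) pM; rewrite ler0c.
have : `|p| ^+ 2 <= (M%:C) ^+ 2 by rewrite ler_pXn2r ?nnegrE ?normr_ge0 ?ler0c.
have -> : M%:C ^+ 2 = (M ^+ 2)%:C by rewrite rmorphXn.
by rewrite lecE => /andP[].
Qed.

Lemma jacobi_bounded_op : bounded_op J.
Proof.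
split; first exact: jacobi_linear.
have [M abM] := ab.
have aM k : sqabs (a k)%:C <= M ^+ 2.
  by apply: sqabs_le; apply: le_trans (abM k); rewrite lerDl.
have bM k : sqabs (b k) <= M ^+ 2.
  by apply: sqabs_le; apply: le_trans (abM k); rewrite lerDr.
have M0 : 0 <= M.
  have := le_trans (addr_ge0 (normr_ge0 _) (normr_ge0 _)) (abM 0%N).
  by rewrite ler0c.
exists (3 * M) => x; apply: hnorm_le; first by rewrite !mulr_ge0 ?hnorm_ge0.
rewrite ip_ell2; apply: ell2_dot_le => n.
have mul_le (c p : R[i]) :
    sqabs c <= M ^+ 2 -> sqabs (c * p) <= M ^+ 2 * sqabs p.
  by move=> cM; rewrite sqabsM ler_wpM2r ?sqabs_ge0.
have sM m : \sum_(0 <= k < m) sqabs (x k) <= ip x x := sum_sqabs_le x m.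
pose prev k := if k is i.+1 then sqabs (x i) else 0.
have prev_le : \sum_(0 <= k < n) prev k <= ip x x.
  case: n => [|n]; first by rewrite big_nil ip_ge0.
  by rewrite big_nat_recl//= add0r; exact: sM.
have next_le : \sum_(0 <= k < n) sqabs (x k.+1) <= ip x x.
  apply: le_trans (sM n.+1).
  by rewrite [leRHS]big_nat_recl// lerDr sqabs_ge0.
have cur_le := sM n.
apply: (@le_trans _ _ (3 * M ^+ 2 *
    (\sum_(0 <= k < n) (prev k + sqabs (x k) + sqabs (x k.+1))))).
  rewrite big_distrr/=; apply: ler_sum => k _.
  rewrite jacobi_seqE; apply: le_trans (sqabs_add3 _ _ _) _.
  rewrite -mulrA ler_wpM2l// [leRHS]mulrDr [X in _ <= X + _]mulrDr.
  apply: lerD; last exact: mul_le.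
  apply: lerD; last exact: mul_le.
  case: k => [|k] /=; last exact: mul_le.
  by rewrite sqabsE/= expr0n/= addr0 mulr0.
have -> : (3 * M * hnorm x) ^+ 2 = 3 * M ^+ 2 * (3 * ip x x).
  by rewrite !exprMn sqr_hnorm; ring.
rewrite ler_wpM2l ?mulr_ge0 ?sqr_ge0//.
have sum3 (f g h : nat -> R) : \sum_(0 <= k < n) (f k + g k + h k) =
    \sum_(0 <= k < n) f k + \sum_(0 <= k < n) g k + \sum_(0 <= k < n) h k.
  by rewrite !big_split.
rewrite (sum3 prev (fun k => sqabs (x k)) (fun k => sqabs (x k.+1))).
move: prev_le cur_le next_le; move: (\sum_(_ <= _ < _) _).
by move: (\sum_(_ <= _ < _) _) (\sum_(_ <= _ < _) _) => p q r; lra.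
Qed.

Definition conj_jacobi x : ell2 R := ell2_conj (J x).

Local Notation A := conj_jacobi.

Lemma conj_jacobiZ c x y : A (c *: x + y) = conjC c *: A x + A y.
Proof. by rewrite /conj_jacobi jacobi_linear ell2_conjZ. Qed.

Lemma conj_jacobi_real : real_bounded A.
Proof.
have A0 : A 0 = 0.
  apply: ell2_ext => k /=; rewrite jacobi_seqE.
  by case: k => [|k]; rewrite !mulr0 !addr0 conjC0.
split.
- by move=> x y; have := conj_jacobiZ 1 x y; rewrite conjC1 !scale1r.
- move=> r x; have := conj_jacobiZ r%:C x 0; rewrite A0 !addr0 conjcE/= => ->.
  by rewrite oppr0.
have [_ [M JM]] := jacobi_bounded_op; exists M => x.
by rewrite ell2_conj_norm.
Qed.

Lemma conj_jacobi_delta n : A (delta R n) =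
  (if n is m.+1 then (a m)%:C *: delta R m else 0) +
  (conjC (b n) *: delta R n + (a n)%:C *: delta R n.+1).
Proof.
apply: ell2_ext => j; rewrite !ell2D !ell2Z /conj_jacobi /= jacobi_seqE.
rewrite !rmorphD !rmorphM/=.
have cR (r : R) : conjC r%:C = r%:C by rewrite conjcE/= oppr0.
have cN (e : bool) : conjC (e%:R : R[i]) = e%:R by rewrite conjC_nat.
rewrite !cR !cN.
(* a matrix entry times a Kronecker symbol only sees one of its indices *)
have move (f : nat -> R[i]) p r : f p * (p == r)%:R = f r * (p == r)%:R :> R[i].
  by have [->|] := eqVneq p r; rewrite ?mulr0.
case: n => [|n]; case: j => [|j]; rewrite ?ell2Z /= ?eqSS ?ell20 ?add0r
  ?rmorphM /= ?cR ?cN ?conjC0 ?mulr0 ?addr0 ?add0r //.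
- exact: (move (fun p => (a p)%:C)).
- by case: n => [|n]; rewrite ?mulr0.
have e1 : (a j)%:C * (j == n.+1)%:R = (a n.+1)%:C * (j == n.+1)%:R :> R[i].
  exact: (move (fun p => (a p)%:C)).
have e2 : conjC (b j.+1) * (j == n)%:R = conjC (b n.+1) * (j == n)%:R :> R[i].
  exact: (move (fun p => conjC (b p.+1))).
have e3 : (a j.+1)%:C * (j.+1 == n)%:R = (a n)%:C * (j.+1 == n)%:R :> R[i].
  exact: (move (fun p => (a p)%:C)).
by rewrite e1 e2 e3; ring.
Qed.

Lemma conj_jacobi_dot_delta x k :
  hdot (A x) (delta R k) = hdot (A (delta R k)) x.
Proof.
rewrite hdot_delta [RHS]hdotC conj_jacobi_delta hdotDr hdotDr !hdotZr.
rewrite /conj_jacobi/= jacobi_seqE; congr (conjC _).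
rewrite !hdot_delta conjCK.
have cR (r : R) : conjC r%:C = r%:C by rewrite conjcE/= oppr0.
by rewrite !cR; case: k => [|k]; rewrite ?hdot0r// hdotZr hdot_delta cR.
Qed.

(** Both sides are continuous and conjugate-linear in the second argument, so
    it is enough to compare them on the standard basis, where the identity is
    the symmetry of the Jacobi matrix. *)
Lemma conj_jacobi_sym : conj_symmetric A.
Proof.
move=> x y.
pose S z := hdot (A x) z = hdot (A z) x.
have subS : submodule S.
  split=> [|c z w].
    by rewrite /S (real_bounded0 conj_jacobi_real) hdot0l hdot0r.
  by rewrite /S conj_jacobiZ hdotDr hdotDl hdotZr hdotZl => -> ->.
have [z [v vS vz] yz] := nearest_point y (submodule_span (delta R)).
have -> : y = z.
  apply/eqP; rewrite -subr_eq0; apply/eqP/delta_total => n.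
  by apply: yz; exact: span_mem.
have Sv n : S (v n).
  by apply: (span_min subS) (vS n) => k; exact: conj_jacobi_dot_delta.
have Av := hcvg_app conj_jacobi_real vz.
have vE n : ip (A x) (v n) = ip (A (v n)) x /\
    ip (A x) ('i *: v n) = ip (A (v n)) ('i *: x).
  by have := Sv n; rewrite /S !hdot_ip => -[].
have lim (p q : ell2 R) (f g : nat -> ell2 R) u w : hcvg f p -> hcvg g q ->
    (forall n, ip u (f n) = ip (g n) w) -> ip u p = ip q w.
  move=> fp gq fg; rewrite ipC.
  have h := hcvg_ip u fp.
  rewrite (_ : (fun n => _) = (fun n => ip (g n) w)) in h.
    exact: cvg_unique h (hcvg_ip w gq).
  by apply/funext => n; rewrite ipC.
apply: ip_hdot_eq.
  by apply: lim vz Av _ => n; exact: (vE n).1.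
by apply: lim (hcvgZ 'i vz) Av _ => n; exact: (vE n).2.
Qed.

Definition jacobi_adjoint x : ell2 R := ell2_conj (J (ell2_conj x)).

Lemma jacobi_adjointP x y : hdot (J x) y = hdot x (jacobi_adjoint y).
Proof.
rewrite -[J x]ell2_conjK -[y in LHS]ell2_conjK ell2_conj_dot -/(A x).
by rewrite conj_jacobi_sym -hdotC.
Qed.

Lemma adjoint_jacobi x : adjoint J x = jacobi_adjoint x.
Proof.
rewrite /adjoint; case: xgetP => [S _ [_ SP]|SN].
  apply: ip_inj => z; rewrite [LHS]ipC [RHS]ipC /ip.
  by rewrite -SP jacobi_adjointP.
exfalso; apply: (SN jacobi_adjoint); split; last exact: jacobi_adjointP.
have [Jlin [M JM]] := jacobi_bounded_op; split=> [c y z|].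
  by rewrite /jacobi_adjoint ell2_conjZ Jlin ell2_conjZ conjCK.
exists M => y; rewrite ell2_conj_norm (le_trans (JM _))//.
by rewrite ell2_conj_norm.
Qed.

(** [adjoint J] composed with [J] is [A ^ 2], which is positive because [A] is
    symmetric for the real inner product; so it has a positive root, and the
    operator selected as [abs_op J] is one. *)
Lemma abs_jacobiP : positive_op (abs_op J) /\
  forall x, abs_op J (abs_op J x) = A (A x).
Proof.
have GE x : (adjoint J \o J) x = A (A x) by rewrite /= adjoint_jacobi.
have [M M0 AM] := real_bounded_ge0 conj_jacobi_real.
have Gp : positive_op (adjoint J \o J).
  apply/positive_opP; split.
  - split; first by move=> c x y; rewrite !GE !conj_jacobiZ conjCK.
    by exists (M * M) => x; rewrite GE (le_trans (AM _))// -mulrA ler_wpM2l.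
  - by move=> x y; rewrite !GE conj_jacobi_sym hdotC conj_jacobi_sym -hdotC.
  - by move=> x; rewrite GE conj_symmetric_ip ?ip_ge0//; exact: conj_jacobi_sym.
have [S [Sp S2 _]] := sqrt_exists Gp.
rewrite /abs_op /sqrt_op; case: xgetP => [S' _ [S'p S'2]|SN].
  by split=> // x; rewrite S'2 GE.
by exfalso; apply: (SN S); split.
Qed.

Hypothesis a_gt0 : forall j, 0 < a j.

(** By the three-term recurrence, a subspace that contains [delta 0] and is
    preserved by [A] contains [delta n.+1] as soon as it contains [delta n] and
    [delta n.-1], because [a n] does not vanish. *)
Lemma conj_jacobi_total z :
  (forall n, hdot (iter n A (delta R 0)) z = 0) -> z = 0.
Proof.
move=> zA; apply: delta_total => n.
pose L := in_span (fun n => iter n A (delta R 0)).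
have [L0 LP] : submodule L := submodule_span _.
have LA x : L x -> L (A x).
  apply: (span_min (S := fun y => L (A y))) => [|k].
    split; first by rewrite (real_bounded0 conj_jacobi_real).
    by move=> c y w; rewrite conj_jacobiZ; exact: LP.
  exact: (span_mem (fun n => iter n A (delta R 0)) k.+1).
have LZ c x : L x -> L (c *: x).
  by move=> Lx; rewrite -[_ *: _]addr0; exact: LP.
have LD x y : L x -> L y -> L (x + y).
  by move=> Lx Ly; rewrite -[x]scale1r; exact: LP.
have Ld k : L (delta R k) /\ L (delta R k.+1).
  have step m : L (if m is l.+1 then (a l)%:C *: delta R l else 0) ->
      L (delta R m) -> L (delta R m.+1).
    set p := (if m is _.+1 then _ else _) => Lp Lm.
    have am : (a m)%:C != 0 :> R[i].
      by rewrite (fmorph_eq0 (real_complex R)) gt_eqF.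
    have -> : delta R m.+1 = (a m)%:C^-1 *:
        (A (delta R m) + (-1) *: (p + conjC (b m) *: delta R m)).
      rewrite conj_jacobi_delta -/p addrA scaleN1r.
      by rewrite [_ + _ + _ *: delta R m.+1]addrC addrK scalerA mulVf ?scale1r.
    apply: (LZ); apply: (LD); first exact: LA.
    by apply: (LZ); apply: (LD) => //; exact: LZ.
  elim: k => [|k [ih1 ih2]].
    have L00 := span_mem (fun n => iter n A (delta R 0)) 0.
    by split=> //; exact: step.
  by split=> //; apply: step => //; exact: LZ.
by apply: (span_min (submodule_orth z) zA); exact: (Ld n).1.
Qed.

End JacobiOperator.

(** * Spectral multiplicity and maximal type of the absolute value *)

Unset Implicit Arguments.

Theorem theorem2p1 (R : realType) (a : nat -> R) (b : nat -> R[i])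
    (ab_bounded : jacobi_bounded a b) (a_gt0 : forall j : nat, 0 < a j) :
  let absJ : ell2 R -> ell2 R := abs_op (jacobi ab_bounded) in
  [/\ multiplicity_le absJ 2,
      maximal_type absJ (delta R 0) &
      simple_spectrum absJ -> cyclic_vector absJ (delta R 0)].
Proof.
have [Tp T2] := abs_jacobiP ab_bounded.
have Ar := conj_jacobi_real ab_bounded; have As := conj_jacobi_sym ab_bounded.
pose A := conj_jacobi ab_bounded; have AA x : A (A x) = _ := esym (T2 x).
have tot := conj_jacobi_total (ab := ab_bounded) a_gt0.
split.
- exact: (@conj_sym_multiplicity _ _ _ A (delta R 0) Tp AA tot).
- exact: (@conj_sym_maximal _ _ _ A (delta R 0) Tp Ar As AA tot).
- exact: (@conj_sym_cyclic _ _ _ A (delta R 0) Tp Ar As AA tot).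
Qed.
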